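(* Let $g\in\mathcal H^\infty(B_{\ell_2},\ell_2)$ with $\|g\|<1$, and let $f_0\in\mathcal A_u(B_{\ell_2})$ be a function which is not weakly continuous at $g(x_0)$ for a certain $x_0\in B_{\ell_2}$. Then the vector-valued cluster set $\mathcal{C\ell}(f_0,g)$ contains an analytic copy of the complex open unit disk $\mathbb D$.
   Context: All spaces are complex and $B_{\ell_2}$ is the open unit ball of $\ell_2$. $\mathcal A_u(B_{\ell_2})$ is the Banach algebra (sup norm) of holomorphic functions $f:B_{\ell_2}\to\mathbb C$ that are uniformly continuous on $B_{\ell_2}$. $\mathcal H^\infty(B_{\ell_2})$ is the Banach algebra of bounded holomorphic functions $B_{\ell_2}\to\mathbb C$ with the sup norm; $\mathcal H^\infty(B_{\ell_2},\ell_2)$ is the Banach space of bounded holomorphic maps $B_{\ell_2}\to\ell_2$ with the sup norm, and $B_{\mathcal H^\infty(B_{\ell_2},\ell_2)}$ is its open unit ball. A function $f\in\mathcal A_u(B_{\ell_2})$ is weakly continuous at $y\in B_{\ell_2}$ if $f:B_{\ell_2}\to\mathbb C$ is continuous at $y$ when $B_{\ell_2}$ carries the (relative) weak topology of $\ell_2$. Vector-valued cluster set: for $f\in\mathcal A_u(B_{\ell_2})$ and $g$ in the closed unit ball of $\mathcal H^\infty(B_{\ell_2},\ell_2)$, $\mathcal{C\ell}(f,g)$ is the set of all $h\in\mathcal H^\infty(B_{\ell_2})$ for which there is a net $(g_\alpha)\subset B_{\mathcal H^\infty(B_{\ell_2},\ell_2)}$ with $g_\alpha\xrightarrow{w^*}g$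 and $f(g_\alpha(y))\to h(y)$ for all $y\in B_{\ell_2}$. Here $g_\alpha\xrightarrow{w^*}g$ (weak-star convergence in $\mathcal H^\infty(B_{\ell_2},\ell_2)$ as a dual space) means, for such nets in the unit ball, that $\langle g_\alpha(y),v\rangle\to\langle g(y),v\rangle$ for all $y\in B_{\ell_2}$ and $v\in\ell_2$. For an open subset $U$ of a complex Banach space, $\mathcal{C\ell}(f,g)$ contains an analytic copy of $U$ if there is an injective map $F:U\to\mathcal H^\infty(B_{\ell_2})$ with $F(U)\subset\mathcal{C\ell}(f,g)$ such that $u\mapsto F(u)(x)$ is holomorphic on $U$ for every $x\in B_{\ell_2}$. *)

(* Defs.v *)
From HB Require Import structures.
From mathcomp Require Import all_boot all_order all_algebra complex.
From mathcomp Require Import all_classical all_reals all_analysis.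
From mathcomp Require Import ring lra.

Set Implicit Arguments.
Unset Strict Implicit.
Unset Printing Implicit Defensive.
Import Order.TTheory GRing.Theory Num.Theory.
Import numFieldNormedType.Exports.
Import ComplexField.

Local Open Scope classical_set_scope.
Local Open Scope ring_scope.

Section square_summable.
Variable R : realType.
Implicit Types x y : nat -> R[i].

Definition sqnorms x : nat -> R := fun k => (Normc.normc (x k)) ^+ 2.

Definition square_summable x : Prop := cvgn (series (sqnorms x)).

Definition ell2norm x : R := Num.sqrt (limn (series (sqnorms x))).

Lemma sqnorms_ge0 x k : 0 <= sqnorms x k. Proof. exact: sqr_ge0. Qed.

Lemma series_sqnorms_nd x : nondecreasing_seq (series (sqnorms x)).
Proof. by apply: nondecreasing_series => n _ _; exact: sqnorms_ge0. Qed.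

Lemma ell2norm_ge0 x : 0 <= ell2norm x. Proof. exact: sqrtr_ge0. Qed.

Lemma lim_sqnorms_ge0 x : square_summable x -> 0 <= limn (series (sqnorms x)).
Proof.
move=> sx; apply: limr_ge => //; apply: nearW => n.
by apply: sumr_ge0 => i _; exact: sqnorms_ge0.
Qed.

Lemma sqr_ell2norm x : square_summable x ->
  ell2norm x ^+ 2 = limn (series (sqnorms x)).
Proof. by move=> sx; rewrite sqr_sqrtr// lim_sqnorms_ge0. Qed.

Lemma series_sqnorms_le x n : square_summable x ->
  series (sqnorms x) n <= ell2norm x ^+ 2.
Proof.
move=> sx; rewrite sqr_ell2norm//.
by apply: nondecreasing_cvgn_le => //; exact: series_sqnorms_nd.
Qed.

Lemma square_summable_bound x (M : R) :
  (forall n, series (sqnorms x) n <= M) -> square_summable x.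
Proof.
move=> xM; apply: nondecreasing_is_cvgn; first exact: series_sqnorms_nd.
by exists M => _ [n _ <-]; exact: xM.
Qed.

Lemma ell2norm_bound x (s : R) : 0 <= s ->
  (forall n, series (sqnorms x) n <= s ^+ 2) -> ell2norm x <= s.
Proof.
move=> s0 xs; rewrite -(ger0_norm s0) -sqrtr_sqr ler_wsqrtr//.
apply: limr_le; first exact: square_summable_bound xs.
by apply: nearW => n; exact: xs.
Qed.

Lemma ell2norm_eq0 x : square_summable x -> ell2norm x = 0 -> x = 0.
Proof.
move=> sx x0; apply/funext => k; apply: Normc.eq0_normc.
have := series_sqnorms_le k.+1 sx; rewrite x0 expr0n/= /series/= big_nat_recr//=.
have S0 : 0 <= \sum_(0 <= i < k) sqnorms x i.
  by apply: sumr_ge0 => i _; exact: sqnorms_ge0.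
move=> Sk; apply/eqP; rewrite -sqrf_eq0 eq_le sqr_ge0 andbT.
by rewrite -/(sqnorms x k); lra.
Qed.

Lemma le_normcD (u v : R[i]) :
  Normc.normc (u + v) <= Normc.normc u + Normc.normc v.
Proof. by rewrite -lecR rmorphD; exact: (ler_normD u v). Qed.

Lemma normc_ge0 (u : R[i]) : 0 <= Normc.normc u.
Proof. by case: u => a b; exact: sqrtr_ge0. Qed.

(* Minkowski's inequality, from (a + b)^2 <= (1 + t/s) a^2 + (1 + s/t) b^2
   with s, t > 0 the two norms *)
Lemma series_sqnormsD x y (s t : R) : 0 < s -> 0 < t ->
  (forall n, series (sqnorms x) n <= s ^+ 2) ->
  (forall n, series (sqnorms y) n <= t ^+ 2) ->
  forall n, series (sqnorms (x + y)) n <= (s + t) ^+ 2.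
Proof.
move=> s0 t0 xs yt n.
apply: (@le_trans _ _ ((1 + t / s) * series (sqnorms x) n
                     + (1 + s / t) * series (sqnorms y) n)).
  rewrite /series/= !mulr_sumr -big_split/=; apply: ler_sum => k _.
  rewrite /sqnorms.
  set a := Normc.normc (x k); set b := Normc.normc (y k).
  have a0 : 0 <= a by exact: normc_ge0.
  have b0 : 0 <= b by exact: normc_ge0.
  apply: (@le_trans _ _ ((a + b) ^+ 2)).
    by rewrite ler_pXn2r ?nnegrE ?normc_ge0 ?addr_ge0//; exact: le_normcD.
  have -> : (1 + t / s) * a ^+ 2 + (1 + s / t) * b ^+ 2 =
     (a + b) ^+ 2 + (t * a - s * b) ^+ 2 / (s * t).
    by field; rewrite !gt_eqF.
  by rewrite lerDl divr_ge0 ?sqr_ge0// mulr_ge0// ltW.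
have -> : (s + t) ^+ 2 = (1 + t / s) * s ^+ 2 + (1 + s / t) * t ^+ 2.
  by field; rewrite !gt_eqF.
by apply: lerD; apply: ler_wpM2l; rewrite ?addr_ge0 ?divr_ge0 ?(ltW s0) ?(ltW t0).
Qed.

Lemma sqnorms0 : sqnorms (0 : nat -> R[i]) = 0.
Proof. by apply/funext => k; rewrite /sqnorms Normc.normc0 expr0n. Qed.

Lemma square_summable0 : square_summable (0 : nat -> R[i]).
Proof.
apply: (@square_summable_bound _ 0) => n.
by rewrite /series/= sqnorms0 big1.
Qed.

Lemma series_sqnormsZ (l : R[i]) x n :
  series (sqnorms (l *: x)) n = Normc.normc l ^+ 2 * series (sqnorms x) n.
Proof.
rewrite /series/= mulr_sumr; apply: eq_bigr => k _.
by rewrite /sqnorms Normc.normcM exprMn.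
Qed.

Lemma square_summableZ (l : R[i]) x :
  square_summable x -> square_summable (l *: x).
Proof.
move=> sx; apply: (@square_summable_bound _ (Normc.normc l ^+ 2 * ell2norm x ^+ 2)).
by move=> n; rewrite series_sqnormsZ ler_wpM2l ?sqr_ge0// series_sqnorms_le.
Qed.

Lemma square_summableD x y :
  square_summable x -> square_summable y -> square_summable (x + y).
Proof.
move=> sx sy; have x0 := ell2norm_ge0 x; have y0 := ell2norm_ge0 y.
apply: (@square_summable_bound _ ((ell2norm x + 1 + (ell2norm y + 1)) ^+ 2)).
apply: series_sqnormsD; [lra|lra|move=> n|move=> n].
- apply: (le_trans (series_sqnorms_le n sx)).
  by rewrite ler_pXn2r ?nnegrE//; lra.
- apply: (le_trans (series_sqnorms_le n sy)).
  by rewrite ler_pXn2r ?nnegrE//; lra.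
Qed.

Lemma ler_ell2normD x y : square_summable x -> square_summable y ->
  ell2norm (x + y) <= ell2norm x + ell2norm y.
Proof.
move=> sx sy.
have [/eqP x0|x0] := boolP (ell2norm x == 0).
  by rewrite x0 (ell2norm_eq0 sx x0) !add0r.
have [/eqP y0|y0] := boolP (ell2norm y == 0).
  by rewrite y0 (ell2norm_eq0 sy y0) !addr0.
apply: ell2norm_bound; first by rewrite addr_ge0 ?ell2norm_ge0.
apply: series_sqnormsD => [||n|n]; rewrite ?lt0r ?x0 ?y0 ?ell2norm_ge0//;
  exact: series_sqnorms_le.
Qed.

Lemma ell2normZ (l : R[i]) x : square_summable x ->
  ell2norm (l *: x) = Normc.normc l * ell2norm x.
Proof.
move=> sx; rewrite /ell2norm.
have -> : series (sqnorms (l *: x)) =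
    (fun n => Normc.normc l ^+ 2 * series (sqnorms x) n).
  by apply/funext => n; exact: series_sqnormsZ.
have -> : limn (fun n => Normc.normc l ^+ 2 * series (sqnorms x) n) =
    Normc.normc l ^+ 2 * limn (series (sqnorms x)).
  by apply: cvg_lim => //; apply: cvgM => //; exact: cvg_cst.
by rewrite sqrtrM ?sqr_ge0// sqrtr_sqr ger0_norm// normc_ge0.
Qed.

End square_summable.

Definition ell2_pred (R : realType) : {pred (nat -> R[i])} :=
  fun x => `[< square_summable x >].

Record ell2 (R : realType) := Ell2 {
  ell2_val :> nat -> R[i];
  ell2_valP : ell2_val \in @ell2_pred R }.

HB.instance Definition _ (R : realType) := [isSub for @ell2_val R].
HB.instance Definition _ (R : realType) := [Choice of ell2 R by <:].

Lemma ell2_submod_closed (R : realType) : submod_closed (@ell2_pred R).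
Proof.
split; first exact/asboolP/square_summable0.
move=> l x y /asboolP sx /asboolP sy; apply/asboolP.
by apply: square_summableD => //; exact: square_summableZ.
Qed.

HB.instance Definition _ (R : realType) :=
  GRing.isSubmodClosed.Build R[i] (nat -> R[i]) (@ell2_pred R)
    (@ell2_submod_closed R).
HB.instance Definition _ (R : realType) :=
  [SubChoice_isSubLmodule of ell2 R by <:].

Section ell2_normed.
Variable R : realType.
Implicit Types x y : ell2 R.

Lemma ell2_summable x : square_summable x.
Proof. exact/asboolP/ell2_valP. Qed.

Let norm x : R[i] := (ell2norm x)%:C%C.

Let norm_triangle x y : norm (x + y) <= norm x + norm y.
Proof.
by rewrite /norm -rmorphD lecR; apply: ler_ell2normD; exact: ell2_summable.
Qed.

Let normZ (l : R[i]) x : norm (l *: x) = `|l| * norm x.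
Proof.
rewrite /norm (_ : `|l| = (Normc.normc l)%:C%C)// -rmorphM; congr (_%:C%C).
by apply: ell2normZ; exact: ell2_summable.
Qed.

Let norm_eq0 x : norm x = 0 -> x = 0.
Proof.
move=> /complexI x0; apply/val_inj.
by apply: ell2norm_eq0 => //; exact: ell2_summable.
Qed.

HB.instance Definition _ := @Lmodule_isNormed.Build R[i] (ell2 R) norm
  norm_triangle normZ norm_eq0.

Lemma ell2_normE x : `|x| = (ell2norm x)%:C%C. Proof. by []. Qed.

End ell2_normed.

Definition ell2_dot (R : realType) (x v : ell2 R) : R[i]^o :=
  limn (series (fun k => x k * (v k)^* : R[i]^o)).

Lemma ell2_dot_cvg (R : realType) (x v : ell2 R) :
  cvgn (series (fun k => x k * (v k)^* : R[i]^o)).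
Proof.
set u : nat -> R[i]^o := fun k => _.
have w_cvg : cvgn (series (sqnorms x + sqnorms v)).
  by apply: is_cvg_seriesD; exact: ell2_summable.
have norm_u k : `|u k| <= ((sqnorms x + sqnorms v) k)%:C%C.
  rewrite /u normrM norm_conjC -[`|x k|]/((Normc.normc (x k))%:C%C).
  rewrite -[`|v k|]/((Normc.normc (v k))%:C%C) -rmorphM lecR fctE /sqnorms.
  by set a := Normc.normc (x k); set b := Normc.normc (v k); nra.
have abs_cvg (p : R[i] -> R) : (forall z, (`|p z|)%:C%C <= `|z|) ->
    cvgn (series (p \o u)).
  move=> pz; apply: normed_cvg.
  apply: (series_le_cvg _ _ _ w_cvg) => k /=; first exact: normr_ge0.
    by rewrite addr_ge0 ?sqnorms_ge0.
  by rewrite -lecR; exact: le_trans (pz _) (norm_u k).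
have re_cvg : cvgn (series (@complex.Re R \o u)).
  by apply: abs_cvg => z; exact: normc_ge_Re.
have im_cvg : cvgn (series (@complex.Im R \o u)).
  apply: abs_cvg => -[a b]; rewrite normc_def lecR /= -sqrtr_sqr.
  by rewrite ler_wsqrtr// lerDr sqr_ge0.
apply/cvg_ex; exists (Complex (limn (series (@complex.Re R \o u)))
                          (limn (series (@complex.Im R \o u)))).
have uE n : series u n = Complex (series (@complex.Re R \o u) n)
                                 (series (@complex.Im R \o u) n).
  rewrite /series/=; elim: n => [|n IH]; first by rewrite !big_geq.
  by rewrite !big_nat_recr//= IH; case: (u n) => a b.
apply/cvgrPdist_lt => e e0.
have [d d0 ->] : exists2 d : R, 0 < d & e = d%:C%C.
  case: e e0 => a b; rewrite ltcE/= => /andP[/eqP -> a0].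
  by exists a.
have d2 : 0 < d / 2 by rewrite divr_gt0.
move/cvgrPdist_lt : re_cvg => /(_ _ d2) re_near.
move/cvgrPdist_lt : im_cvg => /(_ _ d2) im_near.
near=> n; rewrite uE.
have -> : Complex (limn (series (@complex.Re R \o u))) (limn (series (@complex.Im R \o u))) - Complex (series (@complex.Re R \o u) n)
    (series (@complex.Im R \o u) n) =
    (limn (series (@complex.Re R \o u)) - series (@complex.Re R \o u) n)%:C%C
    + 'i%C * (limn (series (@complex.Im R \o u)) - series (@complex.Im R \o u) n)%:C%C by rewrite [LHS]complexE.
apply: le_lt_trans (ler_normD _ _) _; rewrite normrM.
have -> : `|'i%C : R[i]| = 1 by rewrite normc_def/= expr0n/= add0r expr1n sqrtr1.
rewrite mul1r !normc_def /= expr0n/= !addr0 !sqrtr_sqr -rmorphD ltcR.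
rewrite [ltRHS](splitr d) ltrD//; near: n; [exact: re_near|exact: im_near].
Unshelve. all: by end_near. Qed.

(* The weak topology of a normed space: the coarsest one making the continuous
   linear functionals continuous. *)
Definition weak_space (K : numFieldType) (V : normedModType K) : topologicalType :=
  sup_topology (fun phi : {phi : {linear V -> K^o} | continuous phi} =>
    Topological.class (initial_topology (sval phi : V -> K^o))).

(* Functions on an open set U are represented by total functions, whose values
   outside U are irrelevant. *)
Definition holomorphic_on (R : realType) (V W : normedModType R[i])
  (U : set V) (f : V -> W) : Prop := forall x, U x -> differentiable f x.

Definition unit_disk (R : realType) : set R[i]^o := [set z | `|z| < 1].

Section spaces_on_the_ball.
Variable R : realType.

Definition ell2_ball : set (ell2 R) := [set x | `|x| < 1].

Definition supnorm (W : normedModType R[i]) (f : ell2 R -> W) : \bar R :=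
  ereal_sup [set (complex.Re `|f x|)%:E | x in ell2_ball].

Definition Hinfty (W : normedModType R[i]) : set (ell2 R -> W) :=
  [set f | holomorphic_on ell2_ball f /\ (supnorm f < +oo)%E].

Definition Au : set (ell2 R -> R[i]^o) :=
  [set f | holomorphic_on ell2_ball f /\
           unif_continuous (f : subspace ell2_ball -> R[i]^o)].

Definition weakly_continuous_at (f : ell2 R -> R[i]^o) (y : ell2 R) : Prop :=
  f @ within ell2_ball (nbhs (y : weak_space (ell2 R))) --> f y.

End spaces_on_the_ball.
Arguments Hinfty {R} W.

Record directed_set := DirectedSet {
  ds_car :> Type;
  ds_le : ds_car -> ds_car -> Prop;
  ds_inhabited : inhabited ds_car;
  ds_refl : forall i, ds_le i i;
  ds_trans : forall i j k, ds_le i j -> ds_le j k -> ds_le i k;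
  ds_directed : forall i j, exists k, ds_le i k /\ ds_le j k }.

Definition tails (I : directed_set) : set_system I :=
  [set A | exists i, forall j, ds_le i j -> A j].
Arguments tails : clear implicits.

#[global] Instance tails_proper_filter (I : directed_set) :
  ProperFilter (tails I).
Proof.
have [i0] := ds_inhabited I.
split; first by move=> [i iF]; exact: (iF i (ds_refl i)).
split; first by exists i0.
- move=> P Q [i iP] [j jQ]; have [k [ik jk]] := ds_directed i j.
  exists k => l kl; split.
    by apply: iP; exact: ds_trans kl.
  by apply: jQ; exact: ds_trans kl.
- by move=> P Q PQ [i iP]; exists i => j ij; exact/PQ/iP.
Qed.

Section vector_valued_cluster_sets.
Variable R : realType.

(* Weak-star convergence of nets in the unit ball of Hinfty (ell2 R). *)
Definition wstar_cvg (I : directed_set) (G : I -> ell2 R -> ell2 R)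
    (g : ell2 R -> ell2 R) : Prop :=
  forall y v : ell2 R, ell2_ball y ->
    ell2_dot (G i y) v @[i --> tails I] --> ell2_dot (g y) v.

Definition cluster_set (f : ell2 R -> R[i]^o) (g : ell2 R -> ell2 R) :
    set (ell2 R -> R[i]^o) :=
  [set h | Hinfty R[i]^o h /\
    exists (I : directed_set) (G : I -> ell2 R -> ell2 R),
    [/\ forall i, Hinfty (ell2 R) (G i) /\ (supnorm (G i) < 1)%E,
        wstar_cvg G g &
        forall y, ell2_ball y -> f (G i y) @[i --> tails I] --> h y]].

(* Injectivity of F into Hinfty is up to equality on the ball. *)
Definition contains_analytic_copy (V : normedModType R[i])
    (S : set (ell2 R -> R[i]^o)) (U : set V) : Prop :=
  exists F : V -> ell2 R -> R[i]^o,
  [/\ forall u v, U u -> U v ->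
        (forall x, ell2_ball x -> F u x = F v x) -> u = v,
      forall u, U u -> S (F u) &
      forall x, ell2_ball x -> holomorphic_on U (fun u => F u x : R[i]^o)].

End vector_valued_cluster_sets.

(* Main.v *)
(* Put [a = g x0].  Failure of weak continuity yields an ultrafilter [U] on the
ball that converges weakly to [a] while [|f0 p - f0 a| >= e] for [U]-almost
every [p].  For small [t] the maps [g + t (p - a)] stay in a ball of radius
less than 1 and converge weak-star to [g] along [U], so the limit [h_t] of
[f0 (g + t (p - a))] along [U] lies in the cluster set; Cauchy's estimates,
uniform in [p], make [h_t x] holomorphic in [t] and in [x].  At [x = x0] the
limit also exists along the segment [0 <= t < 1], where it is analytic and, by
uniform continuity, stays away from [f0 a] as [t] tends to 1.  By the identity
theorem [t |-> h_t x0] is not constant near 0, hence it is injective on some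
small disc, and this disc is the required analytic copy. *)

Require Import Defs.
From HB Require Import structures.
From mathcomp Require Import all_boot all_order all_algebra complex.
From mathcomp Require Import all_classical all_reals all_analysis.
From mathcomp Require Import ring lra.

Set Implicit Arguments.
Unset Strict Implicit.
Unset Printing Implicit Defensive.
Import Order.TTheory GRing.Theory Num.Theory.
Import numFieldNormedType.Exports.

Local Open Scope classical_set_scope.
Local Open Scope ring_scope.

(** For [x] other than [x0] the points [g x + t (p - a)] may leave the ball long before [t = 1], so
    only small [t] yield members of the cluster set. Only over [x0], where they are convex
    combinations of [a] and [p], is the failure of weak continuity visible, and only for [t] near 1;
    the identity theorem carries it back to small [t]. The disc of parameters that is guaranteed to
    stay admissible shrinks to nothing at [t = 1], hence the appeal to uniform continuity there.

    An ultrafilter, unlike a net, makes the limits exist for all admissible [t] and [x] at once,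
    with no passage to subnets; a net is recovered at the end from the members of [U].

    The one-variable theory rests on real integrals over segments. Goursat's theorem for the real
    part of [q dz / (i z)] in log-polar coordinates gives a mean value inequality on circles.
    Cauchy's estimates, the maximum principle and the identity theorem come from this inequality for
    suitable [q], without contour integrals or power series. *)

Notation Re := complex.Re.
Notation Im := complex.Im.

(** * Norms with real values *)

Section real_valued_norm.
Context {R : realType}.

(* The norm of a complex normed space takes its values in [R[i]]; [rnorm] is
   the same norm with values in [R], where [lra] and [nra] apply. *)
Definition rnorm (V : normedModType R[i]) (x : V) : R := Re `|x|.

Section theory.
Context {V : normedModType R[i]}.
Implicit Types x y : V.

Lemma rnormE x : `|x| = (rnorm x)%:C%C.
Proof. by rewrite RRe_real// normr_real. Qed.

Lemma rnorm_ge0 x : 0 <= rnorm x.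
Proof. by rewrite -ler0c -rnormE. Qed.

Lemma rnorm0 : rnorm (0 : V) = 0.
Proof. by rewrite /rnorm normr0. Qed.

Lemma rnormN x : rnorm (- x) = rnorm x.
Proof. by rewrite /rnorm normrN. Qed.

Lemma rnormBC x y : rnorm (x - y) = rnorm (y - x).
Proof. by rewrite /rnorm distrC. Qed.

Lemma ler_rnormD x y : rnorm (x + y) <= rnorm x + rnorm y.
Proof. by rewrite -lecR rmorphD/= -!rnormE ler_normD. Qed.

Lemma ler_rnormB x y : rnorm (x - y) <= rnorm x + rnorm y.
Proof. by rewrite -(rnormN y) ler_rnormD. Qed.

Lemma ler_rnorm_dist x y z : rnorm (x - z) <= rnorm (x - y) + rnorm (y - z).
Proof. by rewrite (le_trans _ (ler_rnormD _ _))// addrA subrK. Qed.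

Lemma ler_rnorm_sub x y : rnorm x - rnorm y <= rnorm (x - y).
Proof. by have := ler_rnormD (x - y) y; rewrite subrK; lra. Qed.

Lemma rnormZ (l : R[i]) x : rnorm (l *: x) = rnorm (l : R[i]^o) * rnorm x.
Proof. by apply: complexI; rewrite rmorphM/= -!rnormE normrZ. Qed.

Lemma rnorm_eq0 x : rnorm x = 0 -> x = 0.
Proof. by move=> x0; apply/normr0_eq0; rewrite rnormE x0. Qed.

Lemma rnorm_gt0 x : x != 0 -> 0 < rnorm x.
Proof. by rewrite -ltcR -rnormE normr_gt0. Qed.

Lemma near_rnormP x (P : V -> Prop) :
  (\forall y \near x, P y) <->
  exists2 d : R, 0 < d & forall y, rnorm (y - x) < d -> P y.
Proof.
split=> [/nbhs_ballP[e /= e0 eP]|[d d0 dP]].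
  have eE : e = (Re e)%:C%C by rewrite RRe_real// gtr0_real.
  exists (Re e); first by rewrite -ltcR -eE.
  move=> y yx; apply: eP; rewrite -ball_normE /ball_/= rnormE eE ltcR.
  by rewrite rnormBC.
apply/nbhs_ballP; exists d%:C%C; first by rewrite /= ltcR.
move=> y; rewrite -ball_normE /ball_/= rnormE ltcR rnormBC; exact: dP.
Qed.

Lemma cvg_rnormP (T : Type) (F : set_system T) (FF : Filter F) (f : T -> V) x :
  f @ F --> x <->
  forall e : R, 0 < e -> \forall t \near F, rnorm (f t - x) < e.
Proof.
split=> [/cvgrPdist_lt fx e e0|fx].
  have := fx e%:C%C; rewrite ltcR => /(_ e0).
  by apply: filterS => t; rewrite rnormE ltcR rnormBC.
apply/cvgrPdist_lt => e e0.
have eE : e = (Re e)%:C%C by rewrite RRe_real// gtr0_real.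
have := fx (Re e); rewrite -ltcR -eE => /(_ e0).
by apply: filterS => t; rewrite rnormE eE ltcR rnormBC.
Qed.

End theory.

Section scalars.
Implicit Types z w : R[i].

Definition rnormC z : R := rnorm (z : R[i]^o).

Lemma rnormM z w : rnormC (z * w) = rnormC z * rnormC w.
Proof. exact: (rnormZ z (w : R[i]^o)). Qed.

Lemma rnormV z : rnormC z^-1 = (rnormC z)^-1.
Proof. by apply: complexI; rewrite fmorphV/= -!(@rnormE R[i]^o) normfV. Qed.

Lemma rnormC1 : rnormC 1 = 1.
Proof. by rewrite /rnormC /rnorm normr1. Qed.

Lemma rnormC_sqr z : rnormC z ^+ 2 = Re z ^+ 2 + Im z ^+ 2.
Proof.
by apply: complexI; rewrite rmorphXn/= -(@rnormE R[i]^o) -add_Re2_Im2.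
Qed.

Lemma normr_Re_le z : `|Re z| <= rnormC z.
Proof. by rewrite -lecR -(@rnormE R[i]^o) normc_ge_Re. Qed.

Lemma rnormC_ge0 z : 0 <= rnormC z. Proof. exact: rnorm_ge0. Qed.

Lemma rnormC0 : rnormC 0 = 0. Proof. exact: rnorm0. Qed.

Lemma rnormC_gt0 z : z != 0 -> 0 < rnormC z. Proof. exact: (@rnorm_gt0 R[i]^o). Qed.

Lemma ler_rnormCD z w : rnormC (z + w) <= rnormC z + rnormC w.
Proof. exact: ler_rnormD. Qed.

Lemma ler_rnormCB z w : rnormC (z - w) <= rnormC z + rnormC w.
Proof. exact: ler_rnormB. Qed.

Lemma ler_rnormC_dist u z w : rnormC (u - w) <= rnormC (u - z) + rnormC (z - w).
Proof. exact: (@ler_rnorm_dist R[i]^o). Qed.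

Lemma normr_Im_le z : `|Im z| <= rnormC z.
Proof.
rewrite -(ler_pXn2r (ltn0Sn 1)) ?nnegrE ?rnormC_ge0//.
by rewrite rnormC_sqr real_normK ?num_real// lerDr sqr_ge0.
Qed.

Lemma Re_le_rnorm z : Re z <= rnormC z.
Proof. exact: le_trans (ler_norm _) (normr_Re_le z). Qed.

Lemma rnorm_conj z : rnormC z^*%C = rnormC z.
Proof. by rewrite /rnormC /rnorm normcJ. Qed.

Lemma conjM_rnorm z : z^*%C * z = (rnormC z ^+ 2)%:C%C.
Proof. by rewrite rnormC_sqr add_Re2_Im2 mulrC sqr_normc. Qed.

Lemma rnorm_real (x : R) : rnormC x%:C%C = `|x|.
Proof.
by rewrite /rnormC /rnorm normc_def/= expr0n/= addr0 sqrtr_sqr.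
Qed.

Lemma rnorm_le_ReIm z : rnormC z <= `|Re z| + `|Im z|.
Proof.
rewrite -(ler_pXn2r (ltn0Sn 1)) ?nnegrE ?rnormC_ge0 ?addr_ge0//.
rewrite rnormC_sqr sqrrD !real_normK ?num_real//.
have := mulr_ge0 (normr_ge0 (Re z)) (normr_ge0 (Im z)); lra.
Qed.

End scalars.
End real_valued_norm.

(** * Differentiability with real epsilons *)

Section differentials.
Context {R : realType} {V W : normedModType R[i]}.
Implicit Types (f : V -> W) (L : {linear V -> W}).

Lemma bounded_linear_continuous L (K : R) :
  (forall h, rnorm (L h) <= K * rnorm h) -> continuous L.
Proof.
move=> LK x; apply/cvg_rnormP => e e0.
apply/near_rnormP; exists (e / (`|K| + 1)).
  by rewrite divr_gt0// ltr_wpDl.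
move=> y; rewrite ltr_pdivlMr; last by rewrite ltr_wpDl.
rewrite -linearB => yx.
have := LK (y - x); have := rnorm_ge0 (y - x); have := ler_norm K.
move: (normr_ge0 K) => *; nra.
Qed.

Lemma continuous_linear_bounded L :
  continuous L -> exists2 K : R, 0 <= K & forall h, rnorm (L h) <= K * rnorm h.
Proof.
move=> /(_ 0)/cvg_rnormP/(_ 1 ltr01)/near_rnormP[d d0 dL].
exists (2 / d); first by rewrite divr_ge0// ltW.
move=> h; have [->|h0] := eqVneq h 0; first by rewrite linear0 !rnorm0 mulr0.
have n0 := rnorm_gt0 h0.
have c0 : 0 < d / (2 * rnorm h) by rewrite divr_gt0// mulr_gt0.
have /dL : rnorm ((d / (2 * rnorm h))%:C%C *: h - 0) < d.
  rewrite subr0 rnormZ -/(rnormC _) rnorm_real gtr0_norm//.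
  have -> : d / (2 * rnorm h) * rnorm h = d / 2 by field; rewrite gt_eqF.
  lra.
rewrite linear0 subr0 linearZ/= rnormZ -/(rnormC _) rnorm_real gtr0_norm//.
rewrite mulrAC ltr_pdivrMr ?mulr_gt0// => H.
rewrite mulrAC ler_pdivlMr//; lra.
Qed.

(** The explicit bound on [L] records its continuity, which the type of linear maps does not
    carry. *)
Definition is_differential f x L :=
  (exists2 K : R, 0 <= K & forall h, rnorm (L h) <= K * rnorm h) /\
  forall e : R, 0 < e -> exists2 d : R, 0 < d &
    forall h, rnorm h < d -> rnorm (f (x + h) - f x - L h) <= e * rnorm h.

Lemma is_differential_littleo f x L :
  (forall e : R, 0 < e -> exists2 d : R, 0 < d &
    forall h, rnorm h < d -> rnorm (f (x + h) - f x - L h) <= e * rnorm h) <->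
  f \o shift x = cst (f x) + L +o_ 0 id.
Proof.
split=> [H|].
  apply/eqaddoP => e e0.
  have eE : e = (Re e)%:C%C by rewrite RRe_real// gtr0_real.
  have e0' : 0 < Re e by rewrite -ltcR -eE.
  have [d d0 dP] := H _ e0'.
  apply/near_rnormP; exists d => // y; rewrite subr0 => /dP.
  rewrite -lecR rmorphM/= -!rnormE -eE /= !fctE/= opprD addrA.
  by rewrite (addrC x).
move=> /eqaddoP H e e0.
have /near_rnormP[d d0 dP] := H e%:C%C ltac:(by rewrite ltcR).
exists d => // h hd.
have := dP h; rewrite subr0 => /(_ hd); rewrite -lecR rmorphM/= -!rnormE /=.
by rewrite !fctE/= opprD addrA (addrC x).
Qed.

Lemma differentiable_epsP f x :
  differentiable f x <-> exists L, is_differential f x L.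
Proof.
split=> [fx|[L [[K K0 LK] Lo]]].
  exists ('d f x); split.
    by apply: continuous_linear_bounded; exact: diff_continuous.
  by apply/is_differential_littleo; exact: diff_locally.
have Lc : continuous L by exact: bounded_linear_continuous LK.
move/is_differential_littleo : Lo => Lo.
by apply/diff_locallyP; rewrite (diff_unique Lc Lo).
Qed.

End differentials.

(** * Goursat's theorem for real 1-forms *)

Section bisection.
Context {R : realType}.
Implicit Types (I : R -> R -> R -> R -> R).

Lemma nested_intervals (u : nat -> R) (w : R) :
  0 <= w ->
  (forall n, u n <= u n.+1) ->
  (forall n, u n.+1 + w / 2 ^+ n.+1 <= u n + w / 2 ^+ n) ->
  exists x, forall n, u n <= x <= u n + w / 2 ^+ n.
Proof.
move=> w0 un vn.
have wn n : 0 <= w / 2 ^+ n by rewrite divr_ge0// exprn_ge0.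
have u_nd : {homo u : m n / (m <= n)%N >-> m <= n}.
  exact/nondecreasing_seqP.
have v_ni m n : (m <= n)%N -> u n + w / 2 ^+ n <= u m + w / 2 ^+ m.
  by move: m n; apply/(nonincreasing_seqP (fun n => u n + w / 2 ^+ n)).
have ub m n : u m <= u n + w / 2 ^+ n.
  have [mn|/ltnW nm] := leqP m n.
    by rewrite (le_trans (u_nd _ _ mn))// lerDl.
  by rewrite (le_trans _ (v_ni _ _ nm))// lerDl.
exists (sup (range u)) => n; apply/andP; split.
  apply: ub_le_sup; last by exists n.
  by exists (u 0 + w / 2 ^+ 0) => _ [m _ <-].
apply: ge_sup; first by exists (u 0), 0.
by move=> _ [m _ <-].
Qed.

(* The quarter carrying the largest share of [I] is followed down to a point. *)
Lemma bisection_vanish I (a b c d : R) : a < b -> c < d ->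
  (forall a' e b' c' d', a <= a' -> a' <= e -> e <= b' -> b' <= b ->
    c <= c' -> c' <= d' -> d' <= d ->
    I a' b' c' d' = I a' e c' d' + I e b' c' d') ->
  (forall a' b' c' e d', a <= a' -> a' <= b' -> b' <= b ->
    c <= c' -> c' <= e -> e <= d' -> d' <= d ->
    I a' b' c' d' = I a' b' c' e + I a' b' e d') ->
  (forall x y, a <= x <= b -> c <= y <= d -> forall e : R, 0 < e ->
    exists2 r : R, 0 < r & forall a' b' c' d',
      a <= a' -> b' <= b -> c <= c' -> d' <= d ->
      a' <= x <= b' -> c' <= y <= d' -> b' - a' < r -> d' - c' < r ->
      `|I a' b' c' d'| <= e * ((b' - a') + (d' - c')) ^+ 2) ->
  I a b c d = 0.
Proof.
move=> ab cd addl addr Iloc.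
apply/eqP/negP => /negP; rewrite -normr_gt0 => k0.
set k := `|I a b c d| in k0.
pose w := b - a; pose h := d - c.
have w0 : 0 < w by rewrite subr_gt0.
have h0 : 0 < h by rewrite subr_gt0.
pose Q (s : R * R * nat) := let: (x, y, n) := s in
  [/\ a <= x, x + w / 2 ^+ n <= b, c <= y, y + h / 2 ^+ n <= d &
      k / 4 ^+ n <= `|I x (x + w / 2 ^+ n) y (y + h / 2 ^+ n)|].
(* The invariant [Q] is a hypothesis here, so that every triple has a successor and the iteration is
   total; a triple violating [Q] just keeps its corner. *)
pose next (s t : R * R * nat) := let: (x, y, n) := s in let: (x', y', n') := t in
  n' = n.+1 /\
  (Q s -> [/\ Q t, x <= x', x' + w / 2 ^+ n' <= x + w / 2 ^+ n,
    y <= y' & y' + h / 2 ^+ n' <= y + h / 2 ^+ n]).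
have step s : {t | next s t}.
  apply: cid; case: s => [[x y] n].
  have [Qs|nQ] := pselect (Q (x, y, n)); last by exists (x, y, n.+1).
  have [ax xb cy yd kI] := Qs.
  set w' := w / 2 ^+ n.+1; set h' := h / 2 ^+ n.+1.
  have wE : w / 2 ^+ n = w' + w'.
    by rewrite /w' exprS; field; rewrite expf_neq0.
  have hE : h / 2 ^+ n = h' + h'.
    by rewrite /h' exprS; field; rewrite expf_neq0.
  have w'0 : 0 <= w' by rewrite divr_ge0// ?exprn_ge0// ltW.
  have h'0 : 0 <= h' by rewrite divr_ge0// ?exprn_ge0// ltW.
  rewrite wE hE !addrA in xb yd kI.
  have [x' [y' [xx yy kI']]] : exists x' y',
      [/\ x' = x \/ x' = x + w', y' = y \/ y' = y + h' &
         k / 4 ^+ n.+1 <= `|I x' (x' + w') y' (y' + h')|].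
    (* One cut in [x] and two in [y] produce four quarters; were each of them below [k / 4 ^ n.+1],
       their sum could not reach [k / 4 ^ n]. *)
    apply: contrapT => nxy.
    have small x' y' : x' = x \/ x' = x + w' -> y' = y \/ y' = y + h' ->
        `|I x' (x' + w') y' (y' + h')| < k / 4 ^+ n.+1.
      by move=> ? ?; rewrite ltNge; apply/negP => ?; apply: nxy; exists x', y'.
    move: kI; rewrite (addl _ (x + w')); [|lra..].
    rewrite (addr x _ _ (y + h')); try by (clear -ax xb cy yd w'0 h'0; lra).
    rewrite (addr (x + w') _ _ (y + h')); try by (clear -ax xb cy yd w'0 h'0; lra).
    apply/negP; rewrite -ltNge.
    have -> : k / 4 ^+ n = k / 4 ^+ n.+1 + k / 4 ^+ n.+1
                         + (k / 4 ^+ n.+1 + k / 4 ^+ n.+1).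
      by rewrite exprS; field; rewrite expf_neq0.
    by rewrite (le_lt_trans (ler_normD _ _))// ltrD//
      (le_lt_trans (ler_normD _ _))// ltrD// small//; tauto.
  exists (x', y', n.+1); split=> // _; split=> //; rewrite ?wE ?hE -?/w' -?/h';
    try by (case: xx => ->; clear -w'0; lra) || (case: yy => ->; clear -h'0; lra).
  have ax' : a <= x' by case: xx => ->; clear -ax w'0; lra.
  have xb' : x' + w' <= b by case: xx => ->; clear -xb w'0; lra.
  have cy' : c <= y' by case: yy => ->; clear -cy h'0; lra.
  have yd' : y' + h' <= d by case: yy => ->; clear -yd h'0; lra.
  by [].
pose s n := iter n (fun t => sval (step t)) (a, c, 0).
have s0 : s 0 = (a, c, 0) by [].
have sS n : next (s n) (s n.+1) by exact: svalP (step (s n)).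
clearbody s.
pose u n := (s n).1.1; pose v n := (s n).1.2.
have sE n : s n = (u n, v n, n).
  elim: n => [|n IH]; first by rewrite /u /v s0.
  have := sS n; rewrite IH /u /v; case: (s n.+1) => [[x y] m]/= [-> _].
  by [].
have Qs n : Q (s n).
  elim: n => [|n IH].
    by rewrite s0 /= !expr0 !divr1 /w /h !(addrC _ (_ - _)) !subrK; split.
  by have := sS n; rewrite sE (sE n.+1) => -[_]; rewrite -sE => /(_ IH)[].
have sP n : [/\ u n <= u n.+1, u n.+1 + w / 2 ^+ n.+1 <= u n + w / 2 ^+ n,
    v n <= v n.+1 & v n.+1 + h / 2 ^+ n.+1 <= v n + h / 2 ^+ n].
  have := sS n; rewrite sE (sE n.+1) => -[_]; rewrite -sE => /(_ (Qs n)).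
  by case.
have [x xP] : exists x, forall n, u n <= x <= u n + w / 2 ^+ n.
  by apply: nested_intervals => [|n|n]; [exact: ltW|have [] := sP n|have [] := sP n].
have [y yP] : exists y, forall n, v n <= y <= v n + h / 2 ^+ n.
  by apply: nested_intervals => [|n|n]; [exact: ltW|have [] := sP n|have [] := sP n].
have wh0 : 0 < (w + h) ^+ 2 by rewrite exprn_gt0// addr_gt0.
have xab : a <= x <= b.
  by have := xP 0; have := Qs 0; rewrite sE => -[]; lra.
have ycd : c <= y <= d.
  by have := yP 0; have := Qs 0; rewrite sE => -[]; lra.
(* With this [e] the local estimate at level [n] equals [k / 2 / 4 ^ n], half of the lower bound
   kept by [Q]. *)
have e0 : 0 < k / (2 * (w + h) ^+ 2) by rewrite divr_gt0// mulr_gt0.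
have [r r0 rP] := Iloc x y xab ycd _ e0.
have [n nr] : exists n, (w + h) / 2 ^+ n < r.
  have := @cvg_geometric R (w + h) (2^-1).
  have -> : `|2^-1 : R| < 1 by rewrite ger0_norm; lra.
  move=> /(_ isT)/cvgrPdist_lt/(_ r r0)[n _ /(_ n (leqnn n))].
  rewrite sub0r normrN /geometric/= exprVn ger0_norm; first by exists n.
  by rewrite divr_ge0// ?exprn_ge0// addr_ge0// ltW.
have p0 : 0 < 2 ^+ n :> R by rewrite exprn_gt0.
have wh : (w + h) / 2 ^+ n = w / 2 ^+ n + h / 2 ^+ n by rewrite mulrDl.
have wn0 : 0 < w / 2 ^+ n by rewrite divr_gt0.
have hn0 : 0 < h / 2 ^+ n by rewrite divr_gt0.
have := Qs n; rewrite sE => -[au ub cv vd].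
apply/negP; rewrite -ltNge.
apply: (le_lt_trans (rP _ _ _ _ au ub cv vd (xP n) (yP n) _ _)); [lra|lra|].
rewrite !(addrAC _ _ (- _)) !subrr !add0r -wh.
have -> : k / (2 * (w + h) ^+ 2) * ((w + h) / 2 ^+ n) ^+ 2 = k / 2 / 4 ^+ n.
  have -> : 4 ^+ n = (2 ^+ n) ^+ 2 :> R.
    by rewrite -exprM mulnC exprM; congr (_ ^+ _); lra.
  by field; rewrite !gt_eqF// addr_gt0.
rewrite ltr_pM2r ?invr_gt0 ?exprn_gt0//; lra.
Qed.

End bisection.

Section integral_on_segments.
Context {R : realType}.
Notation mu := (@lebesgue_measure R).
Implicit Types f g : R -> R.

Definition segment_integral f (a b : R) := \int[mu]_(x in `[a, b]) f x.
Definition continuous_on_segment f (a b : R) :=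
  forall x, a <= x <= b -> {for x, continuous f}.

Lemma continuous_on_segmentB f g a b :
  continuous_on_segment f a b -> continuous_on_segment g a b ->
  continuous_on_segment (fun x => f x - g x) a b.
Proof. by move=> fc gc x xab; apply: continuousB; [exact: fc|exact: gc]. Qed.

Lemma continuous_segment_integrable f a b :
  continuous_on_segment f a b -> mu.-integrable `[a, b] (EFin \o f).
Proof.
move=> fc; apply: continuous_compact_integrable; first exact: segment_compact.
by apply: continuous_in_subspaceT => x; rewrite inE/= in_itv/=; exact: fc.
Qed.

Lemma segment_integral_split f a e b : a <= e -> e <= b ->
  continuous_on_segment f a b ->
  segment_integral f a b = segment_integral f a e + segment_integral f e b.
Proof.
move=> ae eb fc.
have H := @Rintegral_itvB R f (BLeft a) (BRight b) e.
rewrite /segment_integral addrC -(@Rintegral_itv_obnd_cbnd _ e (BRight b)).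
  by rewrite -H ?bnd_simp ?subrK//; exact: continuous_segment_integrable.
apply: integrableS (continuous_segment_integrable fc) => //.
by apply: subset_itvr; rewrite bnd_simp.
Qed.

Lemma segment_integralD f g a b :
  continuous_on_segment f a b -> continuous_on_segment g a b ->
  segment_integral (fun x => f x + g x) a b =
  segment_integral f a b + segment_integral g a b.
Proof.
by move=> fc gc; apply: RintegralD => //; exact: continuous_segment_integrable.
Qed.

Lemma segment_integral_cst (r : R) a b : a <= b ->
  segment_integral (cst r) a b = r * (b - a).
Proof.
move=> ab; rewrite /segment_integral Rintegral_cst//= lebesgue_measure_itv/=.
by rewrite lte_fin; case: ltgtP ab => // -> _; rewrite subrr.
Qed.

Lemma ler_segment_integral f g a b :
  continuous_on_segment f a b -> continuous_on_segment g a b ->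
  (forall x, a <= x <= b -> f x <= g x) ->
  segment_integral f a b <= segment_integral g a b.
Proof.
by move=> fc gc fg; apply: le_Rintegral => //; exact: continuous_segment_integrable.
Qed.

Lemma segment_integral_dist f (r e : R) a b : a <= b ->
  continuous_on_segment f a b ->
  (forall x, a <= x <= b -> `|f x - r| <= e) ->
  `|segment_integral f a b - r * (b - a)| <= e * (b - a).
Proof.
move=> ab fc fr.
have cc s : continuous_on_segment (cst s) a b by move=> x _; exact: cst_continuous.
have lo : (r - e) * (b - a) <= segment_integral f a b.
  rewrite -segment_integral_cst//; apply: ler_segment_integral => // x /fr.
  by rewrite ler_norml /cst; lra.
have hi : segment_integral f a b <= (r + e) * (b - a).
  rewrite -segment_integral_cst//; apply: ler_segment_integral => // x /fr.
  by rewrite ler_norml /cst; lra.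
by rewrite ler_norml; lra.
Qed.

End integral_on_segments.

Section goursat.
Context {R : realType}.
Implicit Types P Q : R -> R -> R.

(* [P] and [Q] are differentiable at [(x, y)] and dP/dy = dQ/dx (= [b]). *)
Definition closed_at P Q (x y : R) := exists a b c : R,
  forall e : R, 0 < e -> exists2 r : R, 0 < r &
    forall x' y', `|x' - x| < r -> `|y' - y| < r ->
    `|P x' y' - (P x y + a * (x' - x) + b * (y' - y))|
       <= e * (`|x' - x| + `|y' - y|) /\
    `|Q x' y' - (Q x y + b * (x' - x) + c * (y' - y))|
       <= e * (`|x' - x| + `|y' - y|).

Lemma linear_estimate_continuous (f : R -> R) (x k : R) :
  (exists2 r : R, 0 < r & forall x', `|x' - x| < r ->
    `|f x' - f x| <= k * `|x' - x|) -> {for x, continuous f}.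
Proof.
move=> [r r0 fr]; apply/cvgrPdist_lt => e e0.
have k1 : 0 < `|k| + 1 by rewrite ltr_wpDl.
have near_x s : 0 < s -> \forall x' \near x, `|x' - x| < s.
  by move=> s0; near do rewrite distrC; exact: nbhsx_ballx.
near=> x'.
have x'r : `|x' - x| < r by near: x'; exact: near_x.
have x'e : `|x' - x| < e / (`|k| + 1).
  by near: x'; apply: near_x; rewrite divr_gt0.
rewrite distrC; apply: le_lt_trans (fr _ x'r) _.
move: x'e; rewrite ltr_pdivlMr//.
have := ler_norm k; have := normr_ge0 (x' - x); have := normr_ge0 k; nra.
Unshelve. all: by end_near. Qed.

Lemma closed_at_continuous P Q x y : closed_at P Q x y ->
  {for x, continuous (P^~ y)} /\ {for y, continuous (Q x)}.
Proof.
move=> [a [b [c /(_ 1 ltr01)[r r0 rP]]]]; split.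
  apply: (@linear_estimate_continuous _ _ (`|a| + 1)); exists r => // x' xr.
  have [+ _] := rP x' y xr ltac:(by rewrite subrr normr0).
  rewrite subrr mulr0 normr0 !addr0 mul1r opprD addrA => H.
  have -> : P x' y - P x y = (P x' y - P x y - a * (x' - x)) + a * (x' - x).
    by rewrite subrK.
  by rewrite (le_trans (ler_normD _ _))// normrM mulrDl mul1r addrC lerD2l.
apply: (@linear_estimate_continuous _ _ (`|c| + 1)); exists r => // y' yr.
have [_] := rP x y' ltac:(by rewrite subrr normr0) yr.
rewrite subrr mulr0 normr0 addr0 add0r mul1r opprD addrA => H.
have -> : Q x y' - Q x y = (Q x y' - Q x y - c * (y' - y)) + c * (y' - y).
  by rewrite subrK.
by rewrite (le_trans (ler_normD _ _))// normrM mulrDl mul1r addrC lerD2l.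
Qed.

(** The left side is the counterclockwise boundary integral of [P dx + Q dy], grouped by pairs of
    opposite sides. It is additive under cuts, and near a point it is of smaller order than the
    squared size of the rectangle, because the linearized form is closed. *)
Lemma goursat_rectangle P Q (a b c d : R) : a < b -> c < d ->
  (forall x y, a <= x <= b -> c <= y <= d -> closed_at P Q x y) ->
  segment_integral (fun x => P x c - P x d) a b +
  segment_integral (fun y => Q b y - Q a y) c d = 0.
Proof.
move=> ab cd PQ.
pose I a b c d := segment_integral (fun x => P x c - P x d) a b +
  segment_integral (fun y => Q b y - Q a y) c d.
have Pc a' b' y : a <= a' -> b' <= b -> c <= y <= d ->
    continuous_on_segment (P^~ y) a' b'.
  by move=> ? ? ? x ?; apply: (closed_at_continuous (PQ x y _ _)).1; lra.
have Qc c' d' x : c <= c' -> d' <= d -> a <= x <= b ->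
    continuous_on_segment (Q x) c' d'.
  by move=> ? ? ? y ?; apply: (closed_at_continuous (PQ x y _ _)).2; lra.
rewrite -/(I a b c d); apply: bisection_vanish => //.
- move=> a' e b' c' d' aa ae eb bb cc cd' dd; rewrite /I (@segment_integral_split _ _ _ e)//; last first.
    by apply: continuous_on_segmentB; apply: Pc; clear -aa ae eb bb cc cd' dd; lra.
  have -> : segment_integral (fun y => Q b' y - Q a' y) c' d' =
      segment_integral (fun y => (Q b' y - Q e y) + (Q e y - Q a' y)) c' d'.
    by congr segment_integral; apply/funext => y; rewrite addrA subrK.
  rewrite (@segment_integralD _ (fun y => Q b' y - Q e y)); first (clear; lra);
    by apply: continuous_on_segmentB; apply: Qc; clear -aa ae eb bb cc cd' dd; lra.
- move=> a' b' c' e d' aa ab' bb cc ce ed dd; rewrite /I.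
  rewrite (@segment_integral_split _ (fun y => Q b' y - Q a' y) _ e)//; last first.
    by apply: continuous_on_segmentB; apply: Qc; clear -aa ab' bb cc ce ed dd; lra.
  have -> : segment_integral (fun x => P x c' - P x d') a' b' =
      segment_integral (fun x => (P x c' - P x e) + (P x e - P x d')) a' b'.
    by congr segment_integral; apply/funext => x; rewrite addrA subrK.
  rewrite (@segment_integralD _ (fun x => P x c' - P x e)); first (clear; lra);
    by apply: continuous_on_segmentB; apply: Pc; clear -aa ab' bb cc ce ed dd; lra.
move=> x y xab ycd e e0.
have [A [B [C H]]] := PQ x y xab ycd.
have e4 : 0 < e / 4 by rewrite divr_gt0.
have [r r0 rP] := H _ e4; exists r => // a' b' c' d' aa bb cc dd xab' ycd' br dr.
set s := (b' - a') + (d' - c').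
have est x' y' : a' <= x' <= b' -> c' <= y' <= d' ->
    `|P x' y' - (P x y + A * (x' - x) + B * (y' - y))| <= e / 4 * s /\
    `|Q x' y' - (Q x y + B * (x' - x) + C * (y' - y))| <= e / 4 * s.
  move=> x'ab y'cd.
  have xx : `|x' - x| <= b' - a' by rewrite ler_norml; lra.
  have yy : `|y' - y| <= d' - c' by rewrite ler_norml; lra.
  have [] := rP x' y' (le_lt_trans xx br) (le_lt_trans yy dr).
  have le_s : e / 4 * (`|x' - x| + `|y' - y|) <= e / 4 * s.
    by apply: ler_wpM2l; [exact: ltW|exact: lerD].
  by move=> H1 H2; split; apply: le_trans le_s.
(* The linear parts contribute [B (c' - d') (b' - a')] here and its opposite in [IQ]: they cancel
   because [P] and [Q] share the coefficient [B]. *)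
have IP : `|segment_integral (fun x => P x c' - P x d') a' b'
            - (B * (c' - d')) * (b' - a')| <= e / 2 * s * (b' - a').
  apply: segment_integral_dist; first (clear -xab'; lra).
    by apply: continuous_on_segmentB; apply: Pc; clear -aa bb cc dd xab' ycd'; lra.
  move=> x' x'ab.
  have c'd' : c' <= c' <= d' /\ c' <= d' <= d' by clear -ycd'; lra.
  have [P1 _] := est x' c' x'ab c'd'.1.
  have [P2 _] := est x' d' x'ab c'd'.2.
  by move: P1 P2; clear; rewrite !ler_norml; lra.
have IQ : `|segment_integral (fun y => Q b' y - Q a' y) c' d'
            - (B * (b' - a')) * (d' - c')| <= e / 2 * s * (d' - c').
  apply: segment_integral_dist; first (clear -ycd'; lra).
    by apply: continuous_on_segmentB; apply: Qc; clear -aa bb cc dd xab' ycd'; lra.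
  move=> y' y'cd.
  have a'b' : a' <= a' <= b' /\ a' <= b' <= b' by clear -xab'; lra.
  have [_ Q1] := est b' y' a'b'.2 y'cd.
  have [_ Q2] := est a' y' a'b'.1 y'cd.
  by move: Q1 Q2; clear; rewrite !ler_norml; lra.
rewrite /I.
have -> : e * s ^+ 2 = 2 * (e / 2 * s * (b' - a') + e / 2 * s * (d' - c')).
  by rewrite /s; field.
have s0 : 0 <= e / 2 * s * (b' - a') + e / 2 * s * (d' - c').
  have -> : e / 2 * s * (b' - a') + e / 2 * s * (d' - c') = e / 2 * s ^+ 2.
    by rewrite /s; field.
  by rewrite mulr_ge0 ?sqr_ge0// divr_ge0// ltW.
by move: IP IQ s0; clear; rewrite !ler_norml; lra.
Qed.

End goursat.

(** * Complex derivatives and the mean value inequality *)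

Section complex_derivative.
Context {R : realType}.
Implicit Types (f g q : R[i]^o -> R[i]^o) (z d : R[i]).

Definition complex_derivative f z d := forall e : R, 0 < e ->
  exists2 r : R, 0 < r & forall h : R[i], rnormC h < r ->
    rnormC (f (z + h) - f z - d * h) <= e * rnormC h.

Lemma is_differential_complex_derivative (V : normedModType R[i]) (f : V -> R[i]^o)
    (L : {linear V -> R[i]^o}) x v (z : R[i]) :
  is_differential f (x + z *: v) L ->
  complex_derivative (fun w : R[i]^o => f (x + w *: v)) z (L v).
Proof.
move=> [_ Lo] e e0.
have v1 : 0 < rnorm v + 1 by rewrite ltr_wpDl// rnorm_ge0.
have [r r0 rP] := Lo _ (divr_gt0 e0 v1).
exists (r / (rnorm v + 1)); first by rewrite divr_gt0.
move=> h hr; have h0 := rnormC_ge0 h; have v0 := rnorm_ge0 v.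
have hv : rnorm (h *: v) < r.
  rewrite rnormZ -/(rnormC h); move: hr; rewrite ltr_pdivlMr//; nra.
have := rP _ hv; rewrite scalerDl addrA linearZ/= rnormZ -/(rnormC h).
rewrite -[h *: L v]/(h * L v) (mulrC h).
move/le_trans; apply; rewrite mulrAC ler_pdivrMr// -mulrA.
by rewrite ler_wpM2l ?(ltW e0)// ler_wpM2l// lerDl.
Qed.

Lemma differentiable_complexP f z :
  differentiable f (z : R[i]^o) <-> exists d, complex_derivative f z d.
Proof.
split=> [/differentiable_epsP[L]|[d fd]].
  have -> : f = (fun w : R[i]^o => f (0 + w *: (1 : R[i]^o))).
    by apply/funext => w; rewrite add0r -[w *: _]/(w * 1) mulr1.
  have zE : z = 0 + z *: (1 : R[i]^o) by rewrite add0r -[z *: _]/(z * 1) mulr1.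
  rewrite {1}zE => HL; exists (L 1).
  have fE : f = (fun w : R[i]^o => f (0 + w *: (1 : R[i]^o))).
    by apply/funext => w; rewrite add0r -[w *: _]/(w * 1) mulr1.
  by rewrite -fE in HL *; rewrite fE; exact: is_differential_complex_derivative.
apply/differentiable_epsP; exists (GRing.scale d \o idfun : {linear R[i]^o -> R[i]^o}).
split; last by [].
by exists (rnormC d) => [|h]; [exact: rnormC_ge0|rewrite rnormZ].
Qed.

End complex_derivative.

Section real_derivative.
Context {R : realType}.
Implicit Types f : R -> R.

Lemma is_derive_epsP f (x d : R) :
  is_derive x 1 f d <-> forall e : R, 0 < e -> exists2 r : R, 0 < r &
    forall h, `|h| < r -> `|f (x + h) - f x - d * h| <= e * `|h|.
Proof.
split=> [[fx <-] e e0|H].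
  have /eqaddoP/(_ e e0)/nbhs_ballP[r /= r0 rP] := derivable_nbhs fx.
  exists r => // h hr; have := rP h; rewrite /ball/= sub0r normrN => /(_ hr).
  rewrite !fctE/= /cst -![_ *: _]/(_ * _) mulr1 (addrC h) opprD addrA.
  by rewrite (mulrC h).
have dq : (fun h => h^-1 *: ((f \o shift x) (h *: 1) - f x)) @ 0^' --> d.
  apply/cvgrPdist_le => e e0; have [r r0 rP] := H e e0.
  rewrite near_withinE; apply/nbhs_ballP; exists r => //= h.
  rewrite /ball/= sub0r normrN => hr h0.
  rewrite -![_ *: _]/(_ * _) mulr1 (addrC h).
  have -> : d - h^-1 * (f (x + h) - f x) = - (h^-1 * (f (x + h) - f x - d * h)).
    by field.
  rewrite normrN normrM normfV mulrC ler_pdivrMr ?normr_gt0//; exact: rP.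
by split; [apply/cvg_ex; exists d|apply/cvg_lim].
Qed.

End real_derivative.

Section complex_mean_value.
Context {R : realType}.
Implicit Types (f : R[i]^o -> R[i]^o).

(** The real mean value theorem applies to the real part of [conj(w) f(z + t h)], where [w] is the
    total increment of [f]: this function of [t] increases by exactly [|w|^2] over the unit
    interval. *)
Lemma complex_mean_value f (z h : R[i]) (K : R) :
  (forall t : R, 0 <= t <= 1 -> exists2 d, complex_derivative f (z + t%:C%C * h) d &
     rnormC d <= K) ->
  rnormC (f (z + h) - f z) <= K * rnormC h.
Proof.
move=> H; set w : R[i] := f (z + h) - f z.
have [w0|w0] := eqVneq w 0.
  have [d _ dK] := H 0 ltac:(by rewrite lexx ler01).
  by rewrite w0 [X in X <= _]rnorm0 mulr_ge0 ?rnormC_ge0// (le_trans _ dK) ?rnormC_ge0.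
have /choice[d dP] : forall t : R, exists dt : R[i], 0 <= t <= 1 ->
    complex_derivative f (z + t%:C%C * h) dt /\ rnormC dt <= K.
  move=> t.
  have [t01|t01] := boolP (0 <= t <= 1); last by exists 0.
  by have [dt] := H t t01; exists dt.
pose phi (t : R) : R := Re (w^*%C * f (z + t%:C%C * h)).
have phid (t : R) : 0 <= t <= 1 -> is_derive t 1 phi (Re (w^*%C * (d t * h))).
  move=> t01; apply/is_derive_epsP => e e0.
  have [fd _] := dP t t01.
  have n0 : 0 < rnormC w * rnormC h + 1 by rewrite ltr_wpDl// mulr_ge0 ?rnormC_ge0.
  have h1 : 0 < rnormC h + 1 by rewrite ltr_wpDl// rnormC_ge0.
  have [r r0 rP] := fd _ (divr_gt0 e0 n0).
  exists (r / (rnormC h + 1)); first by rewrite divr_gt0.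
  move=> s sr.
  have s0 := normr_ge0 s; have hn0 := rnormC_ge0 h.
  have sh : rnormC (s%:C%C * h) < r.
    rewrite rnormM rnorm_real; move: sr; rewrite ltr_pdivlMr//; nra.
  have := rP _ sh; rewrite rnormM rnorm_real.
  set E := (X in rnormC X) => HE.
  have -> : phi (t + s) - phi t - Re (w^*%C * (d t * h)) * s = Re (w^*%C * E).
    rewrite /phi /E.
    have -> : z + (t + s)%:C%C * h = z + t%:C%C * h + s%:C%C * h.
      by rewrite rmorphD/=; ring.
    have alg (c F1 F0 D k : R[i]) :
        Re (c * F1) - Re (c * F0) - Re (c * (D * k)) * s =
        Re (c * (F1 - F0 - D * (s%:C%C * k))).
      by case: c F1 F0 D k => [? ?] [? ?] [? ?] [? ?] [? ?] /=; ring.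
    exact: alg.
  apply: le_trans (normr_Re_le _) _; rewrite rnormM rnorm_conj.
  apply: le_trans (ler_wpM2l (rnormC_ge0 _) HE) _.
  have -> : rnormC w * (e / (rnormC w * rnormC h + 1) * (`|s| * rnormC h)) =
      e * `|s| * ((rnormC w * rnormC h) / (rnormC w * rnormC h + 1)).
    by field; rewrite gt_eqF.
  rewrite -[leRHS]mulr1 ler_wpM2l ?mulr_ge0 ?(ltW e0)//.
  by rewrite ler_pdivrMr// mul1r lerDl.
have [t t01 tE] : exists2 t, t \in `[0, 1]%R &
    phi 1 - phi 0 = Re (w^*%C * (d t * h)) * (1 - 0).
  apply: (@MVT_segment R phi (fun t => Re (w^*%C * (d t * h))) 0 1) => //.
    move=> t /[!in_itv]/= /andP[t0 t1]; apply: phid; lra.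
  apply: derivable_within_continuous => t /[!in_itv]/= t01.
  by have [] := phid t t01.
move: t01; rewrite in_itv/= => /dP[_ dK].
have phiE : phi 1 - phi 0 = rnormC w ^+ 2.
  rewrite /phi mul1r mul0r addr0 -raddfB -mulrBr/= -/w conjM_rnorm//.
have w0' : 0 < rnormC w by exact: rnorm_gt0.
rewrite -(ler_pM2l w0') -expr2 -phiE tE subr0 mulr1.
apply: le_trans (Re_le_rnorm _) _; rewrite !rnormM rnorm_conj.
by rewrite ler_wpM2l ?rnormC_ge0// ler_wpM2r ?rnormC_ge0.
Qed.

End complex_mean_value.

(** * The complex exponential *)

Section complex_exponential.
Context {R : realType}.
Implicit Types x y : R.

(** This is [e^(x + iy)]; the pair [(x, y)] serves as log-polar coordinates. *)
Definition cexp x y : R[i] := Complex (expR x * cos y) (expR x * sin y).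

Lemma rnorm_cexp x y : rnormC (cexp x y) = expR x.
Proof.
apply/eqP; rewrite -(@eqrXn2 _ 2) ?rnormC_ge0 ?expR_ge0// rnormC_sqr/=.
by rewrite !exprMn -mulrDr cos2Dsin2 mulr1.
Qed.

Lemma cexpD x y x' y' : cexp (x + x') (y + y') = cexp x y * cexp x' y'.
Proof.
apply/eqP; rewrite eq_complex/= expRD cosD sinD.
by apply/andP; split; apply/eqP; ring.
Qed.

Lemma cexp_estimate (e : R) : 0 < e -> exists2 r : R, 0 < r &
  forall x y, `|x| < r -> `|y| < r ->
  rnormC (cexp x y - 1 - Complex x y) <= e * (`|x| + `|y|).
Proof.
(* For [|x| < d / 2] and [d <= 1], [expR x] is within [d] of 1 and at most 2. The errors of the two
   parts then add up to at most [5 d |y| + d |x|], which [d <= e / 6] absorbs. *)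
move=> e0; pose d := Num.min (e / 6) 1.
have d0 : 0 < d by rewrite lt_min divr_gt0//= ltr01.
have d1 : d <= 1 by rewrite ge_min lexx orbT.
have de : d <= e / 6 by rewrite ge_min lexx.
have /is_derive_epsP/(_ d d0)[r1 r10 r1P] := @is_derive_expR R 0.
have /is_derive_epsP/(_ d d0)[r2 r20 r2P] := @is_derive_cos R 0.
have /is_derive_epsP/(_ d d0)[r3 r30 r3P] := @is_derive_sin R 0.
pose r := Num.min (Num.min r1 r2) (Num.min r3 (d / 2)).
exists r; first by rewrite !lt_min r10 r20 r30 divr_gt0.
move=> x y; rewrite !lt_min => /and3P[/andP[xr1 _] _ xd] /and3P[/andP[_ yr2] yr3 _].
have := r1P x xr1; rewrite add0r expR0 mul1r => He.
have := r2P y yr2; rewrite add0r cos0 sin0 oppr0 mul0r subr0 => Hc.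
have := r3P y yr3; rewrite add0r sin0 subr0 cos0 mul1r => Hs.
set X := expR x in He *; set c := cos y in Hc *; set s := sin y in Hs *.
have x0 := normr_ge0 x; have y0 := normr_ge0 y.
have X1 : `|X - 1| <= d.
  have -> : X - 1 = (X - 1 - x) + x by rewrite subrK.
  rewrite (le_trans (ler_normD _ _))//; nra.
have X2 : `|X| <= 2.
  have -> : X = (X - 1) + 1 by rewrite subrK.
  by rewrite (le_trans (ler_normD _ _))// normr1; lra.
apply: le_trans (rnorm_le_ReIm _) _; rewrite /=.
have Hre : `|X * c - 1 - x| <= 2 * (d * `|y|) + d * `|x|.
  have -> : X * c - 1 - x = X * (c - 1) + (X - 1 - x) by ring.
  by rewrite (le_trans (ler_normD _ _))// lerD// normrM ler_pM.
have Him : `|X * s - 0 - y| <= 2 * (d * `|y|) + d * `|y|.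
  have -> : X * s - 0 - y = X * (s - y) + (X - 1) * y by ring.
  rewrite (le_trans (ler_normD _ _))// lerD//.
    by rewrite normrM ler_pM.
  by rewrite normrM ler_wpM2r.
apply: le_trans (lerD Hre Him) _; nra.
Qed.

End complex_exponential.

(** * The mean value inequality on circles *)

Section mean_value_inequality.
Context {R : realType}.
Implicit Types (q : R[i]^o -> R[i]^o).

(** For [z = e^(x + iy)] one has [dz / (i z) = dy - i dx], so the form [Im q dx + Re q dy] is the
    real part of [q dz / (i z)]. *)
Lemma closed_at_polar q (x y : R) :
  differentiable q (cexp x y : R[i]^o) ->
  closed_at (fun x y => Im (q (cexp x y))) (fun x y => Re (q (cexp x y))) x y.
Proof.
move=> /differentiable_complexP[D qD].
set z := cexp x y in qD.
have zx : rnormC z = expR x by exact: rnorm_cexp.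
(* The differential of [q (e^(x + iy))] is [D z (dx + i dy)]; its imaginary and real parts give the
   three coefficients, and the shared one is a Cauchy-Riemann equation. *)
exists (Im (D * z)), (Re (D * z)), (- Im (D * z)) => e e0.
have k0 : 0 < rnormC D * expR x + 1.
  by rewrite ltr_wpDl// mulr_ge0 ?rnormC_ge0 ?expR_ge0.
have e1 : 0 < Num.min 1 (e / (2 * (rnormC D * expR x + 1))).
  by rewrite lt_min ltr01 divr_gt0// mulr_gt0.
have [r1 r10 r1P] := cexp_estimate e1.
have e2 : 0 < e / (6 * expR x) by rewrite divr_gt0// mulr_gt0// expR_gt0.
have [r2 r20 r2P] := qD _ e2.
exists (Num.min r1 (r2 / (6 * expR x))).
  by rewrite lt_min r10 divr_gt0// mulr_gt0// expR_gt0.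
move=> x' y'; set dx := x' - x; set dy := y' - y.
rewrite !lt_min => /andP[dx1 dx2] /andP[dy1 dy2].
have z'E : cexp x' y' = z * cexp dx dy by rewrite -cexpD /dx /dy ![_ + (_ - _)]addrC !subrK.
have dx0 := normr_ge0 dx; have dy0 := normr_ge0 dy.
set n := `|dx| + `|dy| in r1P *.
pose w : R[i] := Complex dx dy.
have wn : rnormC w <= n by exact: rnorm_le_ReIm.
have Hexp := r1P dx dy dx1 dy1; rewrite -/n -/w in Hexp.
set E := cexp dx dy - 1 - w in Hexp.
have n0 : 0 <= n by rewrite addr_ge0.
have En : rnormC E <= n.
  by apply: le_trans Hexp _; rewrite ler_piMl// ge_min lexx.
have Ee : rnormC E <= e / (2 * (rnormC D * expR x + 1)) * n.
  by apply: le_trans Hexp _; rewrite ler_wpM2r// ge_min lexx orbT.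
pose h := z * (w + E).
have z'h : cexp x' y' = z + h by rewrite z'E /h /E; ring.
have hn : rnormC h <= expR x * (2 * n).
  rewrite /h rnormM zx ler_wpM2l ?expR_ge0//.
  by apply: le_trans (ler_rnormD _ _) _; rewrite -/(rnormC _) -/(rnormC _); lra.
have ex0 := expR_gt0 x.
have hr : rnormC h < r2.
  apply: le_lt_trans hn _; move: dx2 dy2; rewrite !ltr_pdivlMr ?mulr_gt0// /n; nra.
have Hq := r2P h hr.
set G := q (z + h) - q z - D * h in Hq.
have Gn : rnormC G <= e / 3 * n.
  apply: le_trans Hq _.
  have -> : e / 3 * n = e / (6 * expR x) * (expR x * (2 * n)) by field; rewrite gt_eqF.
  by rewrite ler_wpM2l// ltW.
have DzE : rnormC (D * (z * E)) <= e / 2 * n.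
  rewrite !rnormM zx mulrA; apply: le_trans (ler_wpM2l _ Ee) _.
    by rewrite mulr_ge0 ?rnormC_ge0 ?ltW.
  have -> : e / 2 * n = (rnormC D * expR x + 1) * (e / (2 * (rnormC D * expR x + 1)) * n).
    by field; rewrite gt_eqF.
  rewrite ler_wpM2r ?lerDl// mulr_ge0// divr_ge0 ?(ltW e0)// mulr_ge0//; exact: ltW.
have key : rnormC (q (cexp x' y') - (q z + D * z * w)) <= e * n.
  have -> : q (cexp x' y') - (q z + D * z * w) = G + D * (z * E).
    by rewrite z'h /G /h; ring.
  apply: le_trans (ler_rnormD _ _) _; rewrite -/(rnormC _) -/(rnormC _).
  have : 0 <= e * n by rewrite mulr_ge0// ltW.
  lra.
split.
  apply: le_trans key; apply: le_trans (normr_Im_le _); rewrite le_eqVlt.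
  apply/orP; left; apply/eqP; congr (`| _ |).
  by rewrite -/z /w; move: (q _) (q _) (D * z) => [? ?] [? ?] [? ?] /=; ring.
apply: le_trans key; apply: le_trans (normr_Re_le _); rewrite le_eqVlt.
apply/orP; left; apply/eqP; congr (`| _ |).
by rewrite -/z /w; move: (q _) (q _) (D * z) => [? ?] [? ?] [? ?] /=; ring.
Qed.

(* Cauchy's theorem in the coordinates [e^(x + iy)] shows that the mean of
   [Re q] over a circle does not depend on its radius. *)
Lemma Re_le_circle q (rho r M : R) : 0 < r -> r < rho ->
  (forall z : R[i], 0 < rnormC z < rho -> differentiable q (z : R[i]^o)) ->
  {for (0 : R[i]^o), continuous q} ->
  (forall z, rnormC z = r -> Re (q z) <= M) ->
  Re (q 0) <= M.
Proof.
move=> r0 rrho qd qc qM; apply/ler_addgt0Pr => e e0.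
have /near_rnormP[d d0 dP] : \forall z \near (0 : R[i]^o), rnorm (q z - q 0) < e.
  by move/cvg_rnormP : qc => /(_ _ e0).
pose s := Num.min r d / 2.
have m0 : 0 < Num.min r d by rewrite lt_min r0 d0.
have s0 : 0 < s by rewrite divr_gt0.
have [sr sd] : s < r /\ s < d.
  have : Num.min r d <= r by rewrite ge_min lexx.
  have : Num.min r d <= d by rewrite ge_min lexx orbT.
  by rewrite /s; lra.
have sr' : ln s < ln r by rewrite ltr_ln.
have pi0 : 0 < (pi *+ 2 : R) by rewrite pmulrn_lgt0// pi_gt0.
pose P (x y : R) := Im (q (cexp x y)); pose Q (x y : R) := Re (q (cexp x y)).
have PQ x y : x <= ln r -> closed_at P Q x y.
  move=> xr; apply: closed_at_polar; apply: qd; rewrite rnorm_cexp expR_gt0/=.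
  by apply: le_lt_trans rrho; rewrite -[leRHS]lnK ?posrE// ler_expR.
have Qc x : x <= ln r -> continuous_on_segment (Q x) 0 (pi *+ 2).
  by move=> xr y _; exact: (closed_at_continuous (PQ x y xr)).2.
have := @goursat_rectangle R P Q _ _ _ _ sr' pi0.
move=> /(_ (fun x y xr _ => PQ x y (proj2 (andP xr)))).
(* The horizontal sides of the rectangle cancel by periodicity, so the integrals over the circles of
   radii [r] and [s] agree. *)
have -> : (fun x => P x 0 - P x (pi *+ 2)) = cst 0.
  apply/funext => x; rewrite /P; apply/eqP; rewrite subr_eq0; apply/eqP.
  by congr (Im (q _)); rewrite /cexp cos2pi sin2pi cos0 sin0.
rewrite segment_integral_cst ?(ltW sr')// mul0r add0r => I0.
(* On the small circle [Re q] exceeds [Re (q 0) - e], on the large one it is at most [M]. The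
   difference has integral 0, so the constant [M - (Re (q 0) - e)] cannot be negative. *)
have : segment_integral (fun y => Q (ln r) y - Q (ln s) y) 0 (pi *+ 2) <=
    segment_integral (cst (M - (Re (q 0) - e))) 0 (pi *+ 2).
  apply: ler_segment_integral.
  - by apply: continuous_on_segmentB; apply: Qc => //; exact: ltW.
  - by move=> ? _; exact: cst_continuous.
  move=> y _; rewrite /cst /Q.
  have Hr : Re (q (cexp (ln r) y)) <= M by apply: qM; rewrite rnorm_cexp lnK// posrE.
  have Hs : Re (q 0) - Re (q (cexp (ln s) y)) < e.
    rewrite -raddfB; apply: le_lt_trans (Re_le_rnorm _) _.
    rewrite /rnormC rnormBC; apply: dP.
    by rewrite subr0 -/(rnormC _) rnorm_cexp lnK ?posrE.
  lra.
rewrite I0 segment_integral_cst ?(ltW pi0)// subr0 pmulr_lge0//; lra.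
Qed.

(** Multiplying [q] by [conj(q 0)] makes the central value real and reduces to real parts. Only
    continuity is asked at 0, so that [q] may be a difference quotient. *)
Lemma rnorm_le_circle q (rho r M : R) : 0 < r -> r < rho ->
  (forall z : R[i], 0 < rnormC z < rho -> differentiable q (z : R[i]^o)) ->
  {for (0 : R[i]^o), continuous q} ->
  (forall z, rnormC z = r -> rnormC (q z) <= M) ->
  rnormC (q 0) <= M.
Proof.
move=> r0 rrho qd qc qM.
have [q0|q0] := eqVneq (q 0) 0.
  have := qM r%:C%C; rewrite rnorm_real gtr0_norm// => /(_ erefl).
  by rewrite q0 rnormC0; apply: le_trans; exact: rnormC_ge0.
have n0 : 0 < rnormC (q 0) by exact: rnorm_gt0.
rewrite -(ler_pM2l n0) -expr2.
have -> : rnormC (q 0) ^+ 2 = Re ((q 0)^*%C * q 0) by rewrite conjM_rnorm.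
have := @Re_le_circle (fun z : R[i]^o => (q 0)^*%C *: q z) rho r
  (rnormC (q 0) * M) r0 rrho.
apply=> [z zr||z zr].
- by apply: differentiableZ; exact: qd.
- by apply: continuousZ; [exact: cst_continuous|].
apply: le_trans (Re_le_rnorm _) _.
by rewrite [_ *: _]/(_ * _) rnormM rnorm_conj ler_wpM2l ?rnormC_ge0// qM.
Qed.

End mean_value_inequality.

Lemma continuous_rnormP (R : realType) (V W : normedModType R[i]) (f : V -> W) x :
  {for x, continuous f} <-> forall e : R, 0 < e -> exists2 d : R, 0 < d &
    forall y, rnorm (y - x) < d -> rnorm (f y - f x) < e.
Proof.
split=> [/cvg_rnormP fc e /fc/near_rnormP//|H].
by apply/cvg_rnormP => e /H?; exact/near_rnormP.
Qed.

(** * Cauchy's estimates *)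

Section complex_derivative_rules.
Context {R : realType}.
Implicit Types (f g : R[i]^o -> R[i]^o) (z d : R[i]).

Lemma complex_derivativeB f g z d d' :
  complex_derivative f z d -> complex_derivative g z d' ->
  complex_derivative (fun w => f w - g w) z (d - d').
Proof.
move=> fd gd e e0; have e2 : 0 < e / 2 by rewrite divr_gt0.
have [r r0 rP] := fd _ e2; have [s s0 sP] := gd _ e2.
exists (Num.min r s); first by rewrite lt_min r0 s0.
move=> h; rewrite lt_min => /andP[/rP Hr /sP Hs].
have -> : f (z + h) - g (z + h) - (f z - g z) - (d - d') * h =
  (f (z + h) - f z - d * h) - (g (z + h) - g z - d' * h) by ring.
apply: le_trans (ler_rnormCB _ _) _; lra.
Qed.

Lemma complex_derivative_shift f z w d :
  complex_derivative f (z + w) d -> complex_derivative (fun u => f (u + w)) z d.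
Proof.
move=> fd e /fd[r r0 rP]; exists r => // h /rP.
by rewrite (addrAC z w h).
Qed.

Lemma complex_derivative_scale d z : complex_derivative (fun w => d * w) z d.
Proof.
move=> e e0; exists 1 => // h _.
have -> : d * (z + h) - d * z - d * h = 0 by ring.
by rewrite rnormC0 mulr_ge0 ?rnormC_ge0// ltW.
Qed.

Lemma differentiable_div f z : z != 0 -> differentiable f (z : R[i]^o) ->
  differentiable (fun w : R[i]^o => f w / w : R[i]^o) (z : R[i]^o).
Proof.
move=> z0 fd.
have vd : differentiable (fun w : R[i]^o => w^-1 : R[i]^o) (z : R[i]^o).
  exact: (@differentiable_Rinv _ z).
exact: (@differentiableM _ _ f _ z fd vd).
Qed.

End complex_derivative_rules.

Section cauchy_estimates.
Context {R : realType}.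
Implicit Types (f : R[i]^o -> R[i]^o) (c z d h : R[i]).

Definition bounded_holomorphic f c (rho M : R) := forall z, rnormC (z - c) < rho ->
  differentiable f (z : R[i]^o) /\ rnormC (f z) <= M.

Lemma bounded_holomorphicW f c rho M c' rho' :
  rnormC (c' - c) + rho' <= rho ->
  bounded_holomorphic f c rho M -> bounded_holomorphic f c' rho' M.
Proof.
move=> cc fM z zc; apply: fM; apply: lt_le_trans cc.
by apply: le_lt_trans (ler_rnormC_dist z c' c) _; rewrite addrC ltrD2l.
Qed.

(** The derivative is the central value of the difference quotient, which on the circle of radius
    [rho / 2] is at most [2 M / (rho / 2)]. *)
Lemma cauchy_derivative f c d (rho M : R) : 0 < rho ->
  bounded_holomorphic f c rho M -> complex_derivative f c d ->
  rnormC d <= 4 * M / rho.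
Proof.
move=> rho0 fM fd.
(* Subtracting [d z] before dividing and adding [d] after makes the value at 0 equal to [d], since
   the inverse of 0 is 0. *)
pose q z : R[i]^o := (f (z + c) - f c - d * z) / z + d.
have q0 : q 0 = d by rewrite /q invr0 mulr0 add0r.
have qE z : z != 0 -> q z = (f (z + c) - f c) / z.
  by move=> z0; rewrite /q mulrBl mulfK// subrK.
have r0 : 0 < rho / 2 by rewrite divr_gt0.
have rr : rho / 2 < rho by lra.
rewrite -q0; apply: (rnorm_le_circle r0 rr).
- move=> z /andP[z0 zrho].
  have zn0 : z != 0.
    by apply/eqP => zz; move: z0; rewrite zz rnormC0 ltxx.
  pose p (w : R[i]^o) : R[i]^o := f (w + c) - f c - d * w.
  suff pd : differentiable p (z : R[i]^o).
    exact: (@differentiableD _ _ _ _ (cst d : R[i]^o -> R[i]^o) z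
      (differentiable_div zn0 pd) (differentiable_cst _ _)).
  have [|/differentiable_complexP[D DP] _] := fM (z + c); first by rewrite addrK.
  apply/differentiable_complexP; exists (D - d).
  apply: complex_derivativeB; last exact: complex_derivative_scale.
  rewrite -[D]subr0; apply: complex_derivativeB; first exact: complex_derivative_shift.
  move=> e e0; exists 1 => // h _; rewrite subrr mul0r subr0 rnormC0.
  by rewrite mulr_ge0 ?rnormC_ge0// ltW.
- apply/continuous_rnormP => e e0.
  have [r r00 rP] := fd _ (divr_gt0 e0 (ltr0Sn _ 1)).
  exists r => // z; rewrite subr0 => /rP; rewrite q0 /q addrK => H.
  have [->|z0] := eqVneq z 0; first by rewrite invr0 mulr0 rnorm0.
  rewrite -/(rnormC _) rnormM rnormV ltr_pdivrMr ?rnorm_gt0//.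
  rewrite (addrC z); apply: le_lt_trans H _; rewrite ltr_pM2r ?rnorm_gt0//; lra.
move=> z zr; have z0 : z != 0.
  by apply/eqP => zz; move: zr; rewrite zz rnormC0; lra.
rewrite qE// rnormM rnormV zr ler_pdivrMr//.
have [|_ M1] := fM (z + c); first by rewrite addrK zr.
have [|_ M2] := fM c; first by rewrite subrr rnormC0.
have -> : 4 * M / rho * (rho / 2) = M + M by field; rewrite gt_eqF.
apply: le_trans (ler_rnormCB _ _) _; exact: lerD.
Qed.

(** The whole segment lies within [rho / 2] of [c], so Cauchy's estimate holds along it with radius
    [rho / 2]. *)
Lemma bounded_holomorphic_lipschitz f c (rho M : R) a h : 0 < rho ->
  bounded_holomorphic f c rho M ->
  rnormC (a - c) < rho / 4 -> rnormC h < rho / 4 ->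
  rnormC (f (a + h) - f a) <= 8 * M / rho * rnormC h.
Proof.
move=> rho0 fM ac hr; apply: complex_mean_value => t /andP[t0 t1].
have hn := rnormC_ge0 h.
have tc : rnormC (a + t%:C%C * h - c) < rho / 2.
  rewrite addrAC; apply: le_lt_trans (ler_rnormCD _ _) _.
  rewrite rnormM rnorm_real ger0_norm//; nra.
have fM' : bounded_holomorphic f (a + t%:C%C * h) (rho / 2) M.
  by apply: bounded_holomorphicW fM; lra.
have [|/differentiable_complexP[D DP] _] := fM (a + t%:C%C * h); first lra.
exists D => //.
have -> : 8 * M / rho = 4 * M / (rho / 2) by field; rewrite gt_eqF.
by apply: cauchy_derivative DP; first lra.
Qed.

(** Cauchy's estimate is applied to the increment [f (z + k) - f z] on the disc of radius [rho / 4],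
    where it is at most [8 M / rho] times [|k|]; hence [128 = 4 * 8 * 4]. *)
Lemma cauchy_derivative_lipschitz f c d k D (rho M : R) : 0 < rho ->
  bounded_holomorphic f c rho M -> complex_derivative f c d ->
  complex_derivative f (c + k) D -> rnormC k < rho / 4 ->
  rnormC (D - d) <= 128 * M / rho ^+ 2 * rnormC k.
Proof.
move=> rho0 fM fd DP kr.
have gM : bounded_holomorphic (fun z => f (z + k) - f z) c (rho / 4)
    (8 * M / rho * rnormC k).
  move=> z zc; split; last first.
    by apply: (bounded_holomorphic_lipschitz (c := c)) => //; lra.
  have [|/differentiable_complexP[D1 D1P] _] := fM z; first lra.
  have [|/differentiable_complexP[D2 D2P] _] := fM (z + k).
    rewrite addrAC; apply: le_lt_trans (ler_rnormCD _ _) _; lra.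
  apply/differentiable_complexP; exists (D2 - D1).
  by apply: complex_derivativeB => //; exact: complex_derivative_shift.
have gd : complex_derivative (fun z => f (z + k) - f z) c (D - d).
  by apply: complex_derivativeB => //; exact: complex_derivative_shift.
apply: le_trans (cauchy_derivative _ gM gd) _; first lra.
suff -> : 4 * (8 * M / rho * rnormC k) / (rho / 4) = 128 * M / rho ^+ 2 * rnormC k.
  by [].
by field; rewrite gt_eqF.
Qed.

(** On the segment from [c] to [c + h] the derivative of [f z - d z] is bounded by the Lipschitz
    estimate for derivatives; the mean value inequality supplies the second factor [|h|]. *)
Lemma cauchy_taylor2 f c d (rho M : R) h : 0 < rho ->
  bounded_holomorphic f c rho M -> complex_derivative f c d ->
  rnormC h < rho / 4 ->
  rnormC (f (c + h) - f c - d * h) <= 128 * M / rho ^+ 2 * rnormC h ^+ 2.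
Proof.
move=> rho0 fM fd hr.
have M0 : 0 <= M.
  have [|_ +] := fM c; first by rewrite subrr rnormC0.
  exact/le_trans/rnormC_ge0.
have hn := rnormC_ge0 h.
have -> : f (c + h) - f c - d * h = (f (c + h) - d * (c + h)) - (f c - d * c).
  by ring.
rewrite expr2 mulrA; apply: (complex_mean_value (f := fun z => f z - d * z)).
move=> t /andP[t0 t1]; set k := t%:C%C * h.
have kh : rnormC k <= rnormC h by rewrite rnormM rnorm_real ger0_norm//; nra.
have kr : rnormC k < rho / 4 by exact: le_lt_trans hr.
have [|/differentiable_complexP[D DP] _] := fM (c + k).
  by rewrite addrAC subrr add0r; lra.
exists (D - d); first exact: complex_derivativeB (complex_derivative_scale _ _).
apply: le_trans (cauchy_derivative_lipschitz rho0 fM fd DP kr) _.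
have : 0 <= 128 * M / rho ^+ 2 by rewrite divr_ge0 ?sqr_ge0// mulr_ge0.
by move=> /ler_wpM2l; apply.
Qed.

(** Some derivative [d] is nonzero, otherwise [f] would be constant by the mean value inequality.
    Near that point [f w - d w] is Lipschitz with constant [|d| / 2], too small to compensate
    [d (u - v)]. *)
Lemma exists_injective_disc f c z (rho M : R) :
  bounded_holomorphic f c rho M -> rnormC (z - c) < rho -> f z != f c ->
  exists t (r : R), [/\ 0 < r, rnormC (t - c) + r <= rho &
    forall u v, rnormC (u - t) < r -> rnormC (v - t) < r -> f u = f v -> u = v].
Proof.
move=> fM zrho fz.
have seg (a b t0 : R[i]) (r t : R) : rnormC (a - t0) < r -> rnormC (b - t0) < r ->
    0 <= t <= 1 -> rnormC (a + t%:C%C * (b - a) - t0) < r.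
  move=> ar br /andP[t0' t1].
  have -> : a + t%:C%C * (b - a) - t0 =
      (1 - t)%:C%C * (a - t0) + t%:C%C * (b - t0) by rewrite rmorphB/=; ring.
  apply: le_lt_trans (ler_rnormCD _ _) _.
  rewrite !rnormM !rnorm_real !ger0_norm//; last lra.
  by have [->|] := eqVneq t 0; [|move=> tn0]; nra.
have [t [d [tc td d0]]] : exists t d, [/\ rnormC (t - c) < rho,
    complex_derivative f t d & d != 0].
  apply: contrapT => noD; move/negP : fz; apply; rewrite -subr_eq0.
  have cc : rnormC (c - c) < rho.
    by rewrite subrr rnormC0; apply: le_lt_trans zrho; exact: rnormC_ge0.
  apply/eqP/(@rnorm_eq0 _ R[i]^o); apply/eqP.
  rewrite eq_le rnorm_ge0 andbT -/(rnormC _).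
  have := @complex_mean_value _ f c (z - c) 0.
  rewrite (addrC c (z - c)) subrK mul0r; apply => s s01.
  have sr := seg _ _ _ _ _ cc zrho s01.
  have [/differentiable_complexP[D DP] _] := fM _ sr.
  exists D => //; have [->|D0] := eqVneq D 0; first by rewrite rnormC0.
  by exfalso; apply: noD; exists (c + s%:C%C * (z - c)), D.
have n0 : 0 < rnormC d by exact: rnormC_gt0.
have M0 : 0 <= M by have [_] := fM t tc; exact/le_trans/rnormC_ge0.
pose del := rho - rnormC (t - c).
have del0 : 0 < del by rewrite subr_gt0.
have ftM : bounded_holomorphic f t del M.
  by apply: bounded_holomorphicW fM; rewrite /del addrC subrK.
pose C := 128 * M / del ^+ 2.
have C0 : 0 <= C by rewrite divr_ge0 ?sqr_ge0// mulr_ge0.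
have C1 : 0 < 2 * (C + 1) by lra.
(* The second bound makes [C r <= |d| / 2], where [C] is the Lipschitz constant of the derivative;
   the first keeps the Lipschitz estimate applicable. *)
pose r := Num.min (del / 4) (rnormC d / (2 * (C + 1))).
have r4 : r <= del / 4 by rewrite ge_min lexx.
have rC : r <= rnormC d / (2 * (C + 1)) by rewrite ge_min lexx orbT.
exists t, r; split; first by rewrite lt_min !divr_gt0.
  by move: r4; rewrite /del; have := del0; rewrite /del; lra.
move=> u v ut vt fuv; apply/eqP; rewrite -subr_eq0; apply/eqP.
have : rnormC ((f (v + (u - v)) - d * (v + (u - v))) - (f v - d * v)) <=
    rnormC d / 2 * rnormC (u - v).
  apply: (complex_mean_value (f := fun z => f z - d * z)) => s s01.
  set w := v + _; have wt : rnormC (w - t) < r by exact: seg.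
  have [|/differentiable_complexP[D DP] _] := ftM w; first lra.
  exists (D - d); first exact: complex_derivativeB (complex_derivative_scale _ _).
  have wE : w = t + (w - t) by rewrite addrC subrK.
  rewrite wE in DP.
  have wt4 : rnormC (w - t) < del / 4 by lra.
  apply: le_trans (cauchy_derivative_lipschitz del0 ftM td DP wt4) _.
  rewrite -/C; move: rC; rewrite ler_pdivlMr//; have := rnormC_ge0 (w - t); nra.
rewrite (addrC v (u - v)) subrK fuv.
have -> : f v - d * u - (f v - d * v) = - (d * (u - v)) by ring.
rewrite /rnormC rnormN -!/(rnormC _) rnormM => H.
apply: (@rnorm_eq0 _ R[i]^o); rewrite -/(rnormC _).
have := rnormC_ge0 (u - v); nra.
Qed.

End cauchy_estimates.

(** * Maximum modulus and the identity theorem *)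

Section identity_theorem.
Context {R : realType}.
Implicit Types (f : R[i]^o -> R[i]^o) (c z d h : R[i]).

(** On the open disc the supremum of [|f|^2] need not be attained. Adding [e |z - c|^2] makes the
    mean over a circle of radius [t] exceed the central value by at least [e t^2], so a point within
    [e t^2] of the supremum cannot lie in the inner disc; it lies in the annulus, where [B]
    applies. *)
Lemma max_modulus f c (rho s B M : R) : 0 < s -> s < rho ->
  bounded_holomorphic f c rho M ->
  (forall z, s <= rnormC (z - c) < rho -> rnormC (f z) <= B) ->
  forall z, rnormC (z - c) < s -> rnormC (f z) <= B.
Proof.
move=> s0 srho fM fB z0 z0s.
have rho0 : 0 < rho by lra.
have B0 : 0 <= B.
  apply: le_trans (rnormC_ge0 (f (c + s%:C%C))) _; apply: fB.
  by rewrite addrAC subrr add0r rnorm_real gtr0_norm// lexx.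
rewrite -(ler_pXn2r (ltn0Sn 1)) ?nnegrE ?rnormC_ge0//.
apply/ler_addgt0Pr => e' e'0.
pose e := e' / (2 * rho ^+ 2).
have r20 : 0 < rho ^+ 2 by rewrite exprn_gt0.
have e0 : 0 < e by rewrite divr_gt0// mulr_gt0.
have e'E : e' = e * rho ^+ 2 + e * rho ^+ 2 by rewrite /e; field; rewrite gt_eqF.
pose u z := rnormC (f z) ^+ 2 + e * rnormC (z - c) ^+ 2.
pose U := [set u z | z in [set z | rnormC (z - c) < rho]].
have rho_sq z : rnormC (z - c) < rho -> e * rnormC (z - c) ^+ 2 <= e * rho ^+ 2.
  move=> zr; rewrite ler_pM2l// ler_pXn2r ?nnegrE ?rnormC_ge0//; exact: ltW.
have supU : has_sup U.
  split; first by exists (u c), c => //=; rewrite subrr rnormC0.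
  exists (M ^+ 2 + e * rho ^+ 2) => _ [z /= zr <-].
  rewrite /u lerD ?rho_sq//.
  have [_ zM] := fM z zr.
  by rewrite ler_pXn2r ?nnegrE ?rnormC_ge0// (le_trans _ zM) ?rnormC_ge0.
pose t := (rho - s) / 2.
have t0 : 0 < t by rewrite divr_gt0// subr_gt0.
have et0 : 0 < e * t ^+ 2 by rewrite mulr_gt0// exprn_gt0.
have [_ [c' /= c'rho <-] c'S] := sup_adherent et0 supU.
have uS z : rnormC (z - c) < rho -> u z <= sup U.
  by move=> zr; apply: sup_upper_bound => //; exists z.
have trho : e * t ^+ 2 <= e * rho ^+ 2.
  by rewrite ler_pM2l// ler_pXn2r ?nnegrE ?ltW//; rewrite /t; lra.
have z0S : rnormC (f z0) ^+ 2 <= sup U.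
  apply: le_trans (uS z0 _); last by lra.
  by rewrite lerDl mulr_ge0 ?sqr_ge0// ltW.
have [sc|c's] := leP s (rnormC (c' - c)).
  have c'B : rnormC (f c') ^+ 2 <= B ^+ 2.
    rewrite ler_pXn2r ?nnegrE ?rnormC_ge0//; apply: fB; lra.
  have := rho_sq c' c'rho; rewrite /u in c'S.
  clear -c'S z0S c'B e'E trho; lra.
(* the mean value inequality at [c'] for the linearization of [u] at [c'] *)
exfalso.
pose q (h : R[i]^o) : R[i]^o :=
  (2 * (f c')^*%C) * f (h + c') + (2 * e%:C%C * (c' - c)^*%C) * h.
have : Re (q 0) <= sup U + rnormC (f c') ^+ 2 - e * rnormC (c' - c) ^+ 2 - e * t ^+ 2.
  have qd z : rnormC z < rho - s -> differentiable q (z : R[i]^o).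
    move=> zr; have [|/differentiable_complexP[D DP] _] := fM (z + c').
      rewrite -addrA; apply: le_lt_trans (ler_rnormCD _ _) _; lra.
    have fd : differentiable (fun h : R[i]^o => f (h + c')) (z : R[i]^o).
      by apply/differentiable_complexP; exists D; exact: complex_derivative_shift.
    have ld : differentiable (fun h : R[i]^o =>
        (2 * e%:C%C * (c' - c)^*%C) * h : R[i]^o) (z : R[i]^o).
      apply/differentiable_complexP; eexists; exact: complex_derivative_scale.
    exact: (@differentiableD _ _ _ _ _ (z : R[i]^o)
      (@differentiableZ _ _ _ _ (2 * (f c')^*%C) (z : R[i]^o) fd) ld).
  have tr : t < rho - s by rewrite /t; lra.
  apply: (@Re_le_circle R q (rho - s) t _ t0 tr).
  - by move=> z /andP[_]; exact: qd.
  - by apply: differentiable_continuous; apply: qd; rewrite rnormC0 subr_gt0.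
  move=> z zt.
  have zr : rnormC (z + c' - c) < rho.
    rewrite -addrA; apply: le_lt_trans (ler_rnormCD _ _) _; lra.
  (* The first term of [q] is handled by [2 Re (conj(v) w) <= |v|^2 + |w|^2]; the real part of the
     second is exactly [e (|z + c' - c|^2 - t^2 - |c' - c|^2)]. *)
  have := uS _ zr; rewrite /u -addrA /q.
  move: zt => /(congr1 (fun x => x ^+ 2)) <-.
  rewrite !rnormC_sqr.
  move: (f (z + c')) => [b1 b2].
  move: (f c') (c' - c) z {zr} => [a1 a2] [d1 d2] [z1 z2] /=.
  have := sqr_ge0 (a1 - b1); have := sqr_ge0 (a2 - b2).
  clear; lra.
have -> : Re (q 0) = 2 * rnormC (f c') ^+ 2.
  rewrite /q mulr0 addr0 add0r -mulrA conjM_rnorm.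
  by rewrite -[2 in LHS]/(2%:R) -(rmorph_nat (real_complex R)) -rmorphM.
rewrite /u in c'S; clear -c'S et0; lra.
Qed.

(** A form of Schwarz's lemma: the maximum principle on circles of radius close to [rho] improves
    the bound of the quotient to [M / rho]. *)
Lemma vanishing_div f (rho e M : R) : 0 < e -> 0 < rho ->
  bounded_holomorphic f 0 rho M ->
  (forall z, rnormC z < e -> f z = 0) ->
  bounded_holomorphic (fun z => f z / z) 0 rho (M / rho).
Proof.
move=> e0 rho0 fM f0.
have M0 : 0 <= M.
  have [|_ +] := fM 0; first by rewrite subrr rnormC0.
  exact/le_trans/rnormC_ge0.
have fd z : rnormC (z - 0) < rho ->
    differentiable (fun z : R[i]^o => f z / z : R[i]^o) (z : R[i]^o).
  move=> zrho; have [->|z0] := eqVneq z 0; last first.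
    by apply: differentiable_div => //; exact: (fM z zrho).1.
  apply/differentiable_complexP; exists 0 => k k0; exists e => // h he.
  rewrite add0r f0// (f0 0) ?rnormC0// !mul0r !subrr rnormC0.
  by rewrite mulr_ge0 ?rnormC_ge0// ltW.
(* The maximum principle presupposes some bound; a crude one follows from [f] being zero where
   [|z| < e]. *)
have fK : bounded_holomorphic (fun z => f z / z) 0 rho (M / e).
  move=> z zrho; split; first exact: fd.
  have [ze|ez] := ltP (rnormC z) e.
    by rewrite f0// mul0r rnormC0 divr_ge0// ltW.
  have z0 : 0 < rnormC z by apply: lt_le_trans ez.
  rewrite rnormM rnormV ler_pM ?rnormC_ge0 ?invr_ge0 ?rnormC_ge0//.
    exact: (fM z zrho).2.
  by rewrite lef_pV2 ?posrE.
move=> z zrho; split; first exact: fd.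
rewrite ler_pdivlMr//; apply/ler_addgt0Pr => k k0.
set n := rnormC (f z / z); have n0 : 0 <= n by exact: rnormC_ge0.
(* The first term puts [z] inside the circle; the second makes the loss [n (rho - r)] at most
   [k]. *)
pose r := Num.max ((rnormC (z - 0) + rho) / 2) (rho - k / (n + 1)).
have n1 : 0 < n + 1 by lra.
have k1 : 0 < k / (n + 1) by rewrite divr_gt0.
have r_lt : r < rho by rewrite gt_max; lra.
have zr : rnormC (z - 0) < r by rewrite lt_max; apply/orP; left; lra.
have r0 : 0 < r by apply: le_lt_trans zr; exact: rnormC_ge0.
have rk : rho <= r + k / (n + 1).
  by rewrite -lerBlDr le_max lexx orbT.
have nr : n <= M / r.
  apply: (max_modulus r0 r_lt fK) zr => w /andP[rw wrho].
  rewrite subr0 in rw.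
  rewrite rnormM rnormV ler_pM ?rnormC_ge0 ?invr_ge0 ?rnormC_ge0//.
    exact: (fM w wrho).2.
  by rewrite lef_pV2 ?posrE//; apply: lt_le_trans rw.
move: nr; rewrite ler_pdivlMr// => nr.
have : n * (k / (n + 1)) <= k.
  by rewrite mulrCA ler_piMr ?(ltW k0)// ler_pdivrMr// mul1r lerDl.
have : n * rho <= n * (r + k / (n + 1)) by rewrite ler_wpM2l.
rewrite mulrDr; clear -nr; lra.
Qed.

(** Dividing by [w] any number [n] of times improves the bound each time, which yields
    [|g w| <= M (|w| / rho)^n]; this tends to 0. *)
Lemma identity_disc f c (rho e M : R) : 0 < e ->
  bounded_holomorphic f c rho M ->
  (forall z, rnormC (z - c) < e -> f z = 0) ->
  forall z, rnormC (z - c) < rho -> f z = 0.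
Proof.
move=> e0 fM f0 z zrho.
have rho0 : 0 < rho by apply: le_lt_trans zrho; exact: rnormC_ge0.
pose g (w : R[i]^o) : R[i]^o := f (w + c).
have gM : bounded_holomorphic g 0 rho M.
  move=> w; rewrite subr0 => wr; have [|+ ?] := fM (w + c); first by rewrite addrK.
  move=> /differentiable_complexP[D DP]; split => //.
  by apply/differentiable_complexP; exists D; exact: complex_derivative_shift.
have g0 w : rnormC w < e -> g w = 0 by move=> we; apply: f0; rewrite addrK.
have gn n : bounded_holomorphic (fun w => g w / w ^+ n) 0 rho (M / rho ^+ n).
  elim: n => [|n IH].
    have -> : (fun w => g w / w ^+ 0) = g.
      by apply/funext => w; rewrite expr0 divr1.
    by rewrite expr0 divr1.
  have -> : (fun w => g w / w ^+ n.+1) = (fun w => g w / w ^+ n / w).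
    by apply/funext => w; rewrite exprSr invfM mulrA.
  rewrite exprSr invfM mulrA.
  by apply: vanishing_div e0 rho0 IH _ => w we; rewrite g0// mul0r.
pose w : R[i] := z - c.
have -> : f z = g w by rewrite /g /w subrK.
apply/eqP/negP => /negP gw0.
have w0 : w != 0.
  by apply: contra gw0 => /eqP ->; rewrite g0// rnormC0.
have nw : 0 < rnormC w by exact: rnormC_gt0.
have ng : 0 < rnormC (g w) by exact: rnormC_gt0.
have gw n : rnormC (g w) <= M * (rnormC w / rho) ^+ n.
  have [|_] := gn n w; first by rewrite subr0.
  rewrite rnormM rnormV.
  have -> : rnormC (w ^+ n) = rnormC w ^+ n.
    by elim: n => [|n IH]; rewrite ?expr0 ?rnormC1// !exprS rnormM IH.
  rewrite ler_pdivrMr ?exprn_gt0// => /le_trans; apply.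
  by rewrite expr_div_n mulrA mulrAC.
have lt1 : `|rnormC w / rho| < 1.
  by rewrite ger0_norm ?divr_ge0 ?(ltW rho0) ?(ltW nw)// ltr_pdivrMr// mul1r.
have := @cvg_geometric R M _ lt1.
move=> /cvgrPdist_lt/(_ _ ng)[n _ /(_ n (leqnn n))].
rewrite sub0r normrN /geometric/= => /(le_lt_trans (ler_norm _)).
by rewrite ltNge gw.
Qed.

(** A chain of discs: up to a fixed [s < 1] the radii stay above [k (1 - s)], so finitely many equal
    steps suffice. *)
Lemma identity_segment f (k e M : R) : 0 < k -> 0 < e ->
  (forall s : R, 0 <= s < 1 -> bounded_holomorphic f s%:C%C (k * (1 - s)) M) ->
  (forall z, rnormC z < e -> f z = 0) ->
  forall s : R, 0 <= s < 1 -> f s%:C%C = 0.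
Proof.
move=> k0 e0 fM f0 s /andP[s0 s1].
pose rho := k * (1 - s).
have rho0 : 0 < rho by rewrite mulr_gt0// subr_gt0.
(* With steps shorter than [rho / 2], the disc of radius [rho / 2] about the next point lies in the
   current disc of radius [rho]. *)
have [N Nrho] : exists N : nat, s / N.+1%:R < rho / 2.
  exists (Num.trunc (2 * s / rho)).
  have := truncnS_gt (2 * s / rho).
  rewrite ltr_pdivrMr// => H; rewrite ltr_pdivrMr ?ltr0Sn//; lra.
pose t n : R := s * (n%:R / N.+1%:R).
have tn n : (n <= N.+1)%N -> exists2 e', 0 < e' &
    forall z, rnormC (z - (t n)%:C%C) < e' -> f z = 0.
  elim: n => [_|n IH nN].
    by exists e => // z; rewrite /t mul0r mulr0 subr0; exact: f0.
  have [e' e'0 e'P] := IH (ltnW nN).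
  have tn01 : 0 <= t n <= s.
    rewrite /t mulr_ge0 ?divr_ge0//= ler_piMr// ler_pdivrMr ?ltr0Sn// mul1r.
    by rewrite ler_nat ltnW.
  have ft : bounded_holomorphic f (t n)%:C%C rho M.
    apply: (@bounded_holomorphicW _ _ (t n)%:C%C (k * (1 - t n))).
      rewrite subrr rnormC0 add0r /rho ler_pM2l//; lra.
    apply: fM; lra.
  have H := identity_disc e'0 ft e'P.
  exists (rho / 2); first by rewrite divr_gt0.
  move=> z zt; apply: H; apply: le_lt_trans (ler_rnormC_dist z (t n.+1)%:C%C _) _.
  have -> : rnormC ((t n.+1)%:C%C - (t n)%:C%C) = s / N.+1%:R.
    rewrite -rmorphB rnorm_real /t -mulrBr -mulrBl -natrB//.
    by rewrite subSnn mul1r ger0_norm// divr_ge0.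
  by rewrite [ltRHS]splitr ltrD.
have [e' e'0 e'P] := tn N.+1 (leqnn _).
by apply: e'P; rewrite /t divff ?mulr1 ?subrr ?rnormC0// pnatr_eq0.
Qed.

End identity_theorem.

(** * Limits of bounded holomorphic families along an ultrafilter *)

Lemma rnorm_limit_le (R : realType) (T : Type) (F : set_system T)
    {FF : ProperFilter F} (phi : T -> R[i]) (l : R[i]^o) (M : R) :
  (phi : T -> R[i]^o) @ F --> l -> (\forall p \near F, rnormC (phi p) <= M) ->
  rnormC l <= M.
Proof.
move=> /cvg_rnormP phil phiM; apply/ler_addgt0Pr => e e0.
have [p [pM pe]] := filter_ex (filterI phiM (phil e e0)).
have := ler_rnormCD (phi p) (l - phi p); rewrite (addrC (phi p)) subrK.
have : rnormC (l - phi p) < e by rewrite /rnormC rnormBC.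
lra.
Qed.

Section ultralimits.
Context {R : realType} {T : Type} {U : set_system T} {UU : UltraFilter U}.

(** Compactness gives a cluster point, and an ultrafilter converges to its cluster points. *)
Lemma real_ultralimit_exists (phi : T -> R) (M : R) :
  (\forall p \near U, `|phi p| <= M) -> exists l : R, phi @ U --> l.
Proof.
move=> phiM.
have : compact `[(- M), M]%classic by exact: segment_compact.
move=> /(_ (phi @ U)) [|l [_ lcl]].
  by apply: filterS phiM => p /=; rewrite in_itv/= ler_norml.
exists l; apply/cvgrPdist_lt => e e0.
have [//|Ue] := in_ultra_setVsetC [set p | `|l - phi p| < e] UU.
have [] := lcl [set y | ~ `|l - y| < e] (ball l e) Ue (nbhsx_ballx _ _ e0).
by move=> y [].
Qed.

Lemma ultralimit_exists (phi : T -> R[i]) (M : R) :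
  (\forall p \near U, rnormC (phi p) <= M) ->
  exists l : R[i]^o, (phi : T -> R[i]^o) @ U --> l.
Proof.
move=> phiM.
have [a /cvgrPdist_lt aP] : exists a : R, (fun p => Re (phi p)) @ U --> a.
  apply: (@real_ultralimit_exists _ M); apply: filterS phiM => p.
  exact/le_trans/normr_Re_le.
have [b /cvgrPdist_lt bP] : exists b : R, (fun p => Im (phi p)) @ U --> b.
  apply: (@real_ultralimit_exists _ M); apply: filterS phiM => p.
  exact/le_trans/normr_Im_le.
exists (Complex a b : R[i]^o); apply/cvg_rnormP => e e0.
have e2 : 0 < e / 2 by rewrite divr_gt0.
near=> p; apply: le_lt_trans (rnorm_le_ReIm _) _.
rewrite [ltRHS]splitr !raddfB/= ltrD// distrC; near: p; [exact: aP|exact: bP].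
Unshelve. all: by end_near. Qed.

End ultralimits.

Section limits_of_holomorphic_maps.
Context {R : realType} {V : normedModType R[i]}.
Implicit Types (f : V -> R[i]^o) (x h : V).

Lemma bounded_holomorphic_line f x h (rho M : R) : 0 < rho -> h != 0 ->
  (forall y, rnorm (y - x) < rho -> differentiable f y /\ rnormC (f y) <= M) ->
  bounded_holomorphic (fun w => f (x + w *: h)) 0 (rho / rnorm h) M.
Proof.
move=> rho0 h0 fM w; rewrite subr0 ltr_pdivlMr ?rnorm_gt0// => wr.
have [|/differentiable_epsP[L fL] fw] := fM (x + w *: h).
  by rewrite addrAC subrr add0r rnormZ.
split=> //; apply/differentiable_complexP; exists (L h).
exact: is_differential_complex_derivative.
Qed.

Lemma is_differential_line f x h L : is_differential f x L ->
  complex_derivative (fun w : R[i]^o => f (x + w *: h)) 0 (L h).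
Proof.
move=> fL; apply: is_differential_complex_derivative.
by rewrite scale0r addr0.
Qed.

Lemma is_differential_bound f x L h (rho M : R) : 0 < rho ->
  (forall y, rnorm (y - x) < rho -> differentiable f y /\ rnormC (f y) <= M) ->
  is_differential f x L -> rnormC (L h) <= 4 * M / rho * rnorm h.
Proof.
move=> rho0 fM fL; have [->|h0] := eqVneq h 0.
  by rewrite linear0 rnormC0 rnorm0 mulr0.
have n0 := rnorm_gt0 h0.
have := cauchy_derivative (divr_gt0 rho0 n0) (bounded_holomorphic_line rho0 h0 fM)
  (is_differential_line h fL).
suff -> : 4 * M / (rho / rnorm h) = 4 * M / rho * rnorm h by [].
by field; rewrite !gt_eqF.
Qed.

(** The one-variable estimate is read at [w = 1] on the complex line through [x] in direction [h],
    where the available radius is [rho / |h|]. *)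
Lemma is_differential_taylor2 f x L h (rho M : R) : 0 < rho ->
  (forall y, rnorm (y - x) < rho -> differentiable f y /\ rnormC (f y) <= M) ->
  is_differential f x L -> rnorm h < rho / 4 ->
  rnormC (f (x + h) - f x - L h) <= 128 * M / rho ^+ 2 * rnorm h ^+ 2.
Proof.
move=> rho0 fM fL hr; have [->|h0] := eqVneq h 0.
  by rewrite linear0 addr0 subrr subr0 rnormC0 rnorm0 expr0n mulr0.
have n0 := rnorm_gt0 h0.
have r1 : rnormC 1 < rho / rnorm h / 4.
  by rewrite rnormC1 ltr_pdivlMr// ltr_pdivlMr//; lra.
have := cauchy_taylor2 (divr_gt0 rho0 n0) (bounded_holomorphic_line rho0 h0 fM)
  (is_differential_line h fL) r1.
rewrite add0r scale1r scale0r addr0 mulr1 rnormC1 expr1n mulr1.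
suff -> : 128 * M / (rho / rnorm h) ^+ 2 = 128 * M / rho ^+ 2 * rnorm h ^+ 2 by [].
by field; rewrite !gt_eqF.
Qed.

(* By Cauchy's estimates the remainders of the first-order expansions are
   uniformly quadratic, hence survive in the limit. *)
Lemma ultralimit_differentiable (T : Type) (U : set_system T)
    (UU : UltraFilter U) (phi : T -> V -> R[i]^o) (psi : V -> R[i]^o) x (rho M : R) :
  0 < rho ->
  (\forall p \near U, forall y, rnorm (y - x) < rho ->
     differentiable (phi p) y /\ rnormC (phi p y) <= M) ->
  (forall y, rnorm (y - x) < rho -> phi ^~ y @ U --> psi y) ->
  differentiable psi x.
Proof.
move=> rho0 phiM phipsi.
have M0 : 0 <= M.
  have [p /(_ x)[|_]] := filter_ex phiM; first by rewrite subrr rnorm0.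
  exact/le_trans/rnormC_ge0.
have xx : rnorm (x - x) < rho by rewrite subrr rnorm0.
(* Differentials are needed for [U]-almost every [p] only; the zero map fills in elsewhere. *)
have /choice[L LP] : forall p, exists L : {linear V -> R[i]^o},
    (forall y, rnorm (y - x) < rho ->
     differentiable (phi p) y /\ rnormC (phi p y) <= M) -> is_differential (phi p) x L.
  move=> p; have [pM|pM] := pselect (forall y, rnorm (y - x) < rho ->
     differentiable (phi p) y /\ rnormC (phi p y) <= M); last by exists \0.
  by have [/differentiable_epsP[L fL] _] := pM x xx; exists L.
have L_bound h : \forall p \near U, rnormC (L p h) <= 4 * M / rho * rnorm h.
  by apply: filterS phiM => p pM; apply: is_differential_bound (LP p pM).
have /choice[D DP] : forall h, exists l : R[i]^o, (fun p => L p h) @ U --> l.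
  by move=> h; exact: ultralimit_exists (L_bound h).
have Dlin : linear D.
  move=> a h k; apply: (cvg_unique _ (DP (a *: h + k))).
    exact: norm_hausdorff.
  have -> : (fun p => L p (a *: h + k)) = (fun p => a *: L p h + L p k).
    by apply/funext => p; rewrite linearP.
  by apply: cvgD; [apply: cvgZr; exact: DP|exact: DP].
pose DL : {linear V -> R[i]^o} :=
  HB.pack D (GRing.isLinear.Build R[i] V R[i]^o *:%R D Dlin).
apply/differentiable_epsP; exists DL; split.
  exists (4 * M / rho) => [|h]; first by rewrite divr_ge0 ?(ltW rho0)// mulr_ge0.
  exact: rnorm_limit_le (DP h) (L_bound h).
move=> e e0; pose C := 128 * M / rho ^+ 2.
have C0 : 0 <= C by rewrite divr_ge0 ?sqr_ge0// mulr_ge0.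
have C1 : 0 < C + 1 by lra.
exists (Num.min (rho / 4) (e / (C + 1))); first by rewrite lt_min !divr_gt0.
move=> h; rewrite lt_min => /andP[hr]; rewrite ltr_pdivlMr// => hC.
have hn := rnorm_ge0 h.
apply: (@le_trans _ _ (C * rnorm h ^+ 2)); last by nra.
have xh : rnorm (x + h - x) < rho by rewrite addrAC subrr add0r; lra.
apply: (@rnorm_limit_le R T U _ (fun p => phi p (x + h) - phi p x - L p h)).
  by apply: cvgB; [apply: cvgB; exact: phipsi|exact: DP].
by apply: filterS phiM => p pM; exact: is_differential_taylor2 (LP p pM) hr.
Qed.

End limits_of_holomorphic_maps.

(** * Weak convergence in the ball of l2 *)

Section weak_topology.
Context {R : realType} {V : normedModType R[i]}.

Lemma weak_cvg_functional (phi : {linear V -> R[i]^o}) (y : V) :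
  continuous phi -> phi @ nbhs (y : weak_space V) --> phi y.
Proof.
move=> phic.
pose i : {phi : {linear V -> R[i]^o} | continuous phi} := exist _ phi phic.
have yi : nbhs (y : weak_space V) --> (y : initial_topology (phi : V -> R[i]^o)).
  by have /cvg_sup/(_ i) := @cvg_id _ (nbhs (y : weak_space V)).
have ic : continuous
    ((phi : V -> R[i]^o) : initial_topology (phi : V -> R[i]^o) -> R[i]^o).
  exact: initial_continuous.
by apply: cvg_trans (ic y); exact: cvg_app.
Qed.

End weak_topology.

Section ell2_functionals.
Context {R : realType}.
Implicit Types x y v : ell2 R.

Lemma rnormC_normc (z : R[i]) : rnormC z = Normc.normc z. Proof. by []. Qed.

Lemma ell2_dot_linear v : linear (fun x => ell2_dot x v).
Proof.
move=> a x y; apply: cvg_lim => //.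
have -> : series (fun k => (a *: x + y) k * (v k)^* : R[i]^o) =
    (fun n => a *: series (fun k => x k * (v k)^* : R[i]^o) n +
              series (fun k => y k * (v k)^* : R[i]^o) n).
  apply/funext => n; rewrite /series/= scaler_sumr -big_split/=.
  by apply: eq_bigr => k _; rewrite -[a *: (_ * _)]/(a * (_ * _)) mulrA -mulrDl.
by apply: cvgD; [apply: cvgZr|]; exact: ell2_dot_cvg.
Qed.

(** This additive bound replaces the Cauchy-Schwarz inequality: on normalized [x] it already shows
    that the functional is bounded. *)
Lemma ell2_dot_bound x v :
  rnormC (ell2_dot x v) <= rnorm x ^+ 2 + rnorm v ^+ 2.
Proof.
apply: (rnorm_limit_le (F := \oo) (l := ell2_dot x v)
  (phi := series (fun k => x k * (v k)^* : R[i]^o))); first exact: ell2_dot_cvg.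
apply: nearW => n.
apply: (@le_trans _ _ (series (sqnorms x) n + series (sqnorms v) n)); last first.
  by apply: lerD; apply: series_sqnorms_le; exact: ell2_summable.
rewrite /series/= -big_split/=; elim: n => [|n IH].
  by rewrite !big_geq// rnormC0.
rewrite !big_nat_recr//=; apply: le_trans (ler_rnormCD _ _) _; apply: lerD => //.
rewrite rnormM rnorm_conj /sqnorms -!rnormC_normc.
have := sqr_ge0 (rnormC (x n) - rnormC (v n)).
have := sqr_ge0 (rnormC (x n)); have := sqr_ge0 (rnormC (v n)); lra.
Qed.

Lemma ell2_dot_functional v :
  exists2 phi : {linear ell2 R -> R[i]^o}, continuous phi &
    forall x, phi x = ell2_dot x v.
Proof.
pose d x := ell2_dot x v; pose dlin : linear d := ell2_dot_linear v.
pose phi : {linear ell2 R -> R[i]^o} :=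
  HB.pack d (GRing.isLinear.Build R[i] (ell2 R) R[i]^o *:%R d dlin).
exists phi => //.
apply: (@bounded_linear_continuous _ _ _ phi (1 + rnorm v ^+ 2)) => x.
have [->|x0] := eqVneq x 0; first by rewrite linear0 !rnorm0 mulr0.
have n0 := rnorm_gt0 x0.
have := ell2_dot_bound ((rnorm x)^-1%:C%C *: x) v.
have -> : ell2_dot ((rnorm x)^-1%:C%C *: x) v = (rnorm x)^-1%:C%C * phi x.
  exact: (linearZZ phi).
rewrite rnormM rnormZ -/(rnormC _) rnorm_real ger0_norm ?invr_ge0 ?rnorm_ge0//.
by rewrite mulVf ?gt_eqF// expr1n mulrC ler_pdivrMr.
Qed.

(** For some [e] the set of [p] with [|f p - f y| >= e] meets every weak neighbourhood of [y] in the
    ball. The trace of the neighbourhood filter on this set is therefore proper, and an ultrafilter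
    refines it. *)
Lemma not_weakly_continuous_ultrafilter (f : ell2 R -> R[i]^o) y :
  ell2_ball y -> ~ weakly_continuous_at f y ->
  exists (U : set_system (ell2 R)) (e : R), [/\ UltraFilter U, 0 < e, U (@ell2_ball R),
    forall phi : {linear ell2 R -> R[i]^o}, continuous phi -> phi @ U --> phi y &
    U [set p | e <= rnormC (f p - f y)]].
Proof.
move=> yB nwc.
pose W := within (@ell2_ball R) (nbhs (y : weak_space (ell2 R))).
have [e e0 We] : exists2 e : R, 0 < e & ~ W [set p | rnormC (f p - f y) < e].
  apply: contrapT => H; apply: nwc; apply/cvg_rnormP => e e0.
  by apply: contrapT => We; apply: H; exists e.
pose F := within [set p | e <= rnormC (f p - f y)] W.
have FF : ProperFilter F.
  apply: Build_ProperFilter_ex => P FP.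
  apply: contrapT => nP; apply: We.
  have WP : W [set p | e <= rnormC (f p - f y) -> P p] by exact: FP.
  apply: filterS WP => p /= pP.
  by rewrite ltNge; apply/negP => /pP Pp; apply: nP; exists p.
have [U [UU FU]] := ultraFilterLemma FF.
have WU : W `<=` U.
  move=> A WA; apply: FU; have : W A by [].
  by apply: filterS => p Ap _.
exists U, e; split=> //.
- by apply: WU; exact: withinT.
- move=> phi phic A phiA; apply: WU.
  have : nbhs (y : weak_space (ell2 R)) (phi @^-1` A).
    exact: (@weak_cvg_functional _ _ phi y phic A phiA).
  by apply: filterS => p Ap _.
- by apply: FU; exact: withinT.
Qed.

End ell2_functionals.

(** * Uniform continuity and sup norms on the ball *)

Section uniform_continuity_on_the_ball.
Context {R : realType}.
Implicit Types (f : ell2 R -> R[i]^o) (x y : ell2 R).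

Lemma ell2_ballE x : ell2_ball x = (rnorm x < 1) :> Prop.
Proof. by rewrite /ell2_ball/= rnormE (ltcR _ 1). Qed.

Lemma Au_uniform f : Au f -> forall e : R, 0 < e -> exists2 d : R, 0 < d &
  forall x y, ell2_ball x -> ell2_ball y -> rnorm (x - y) < d ->
    rnormC (f x - f y) < e.
Proof.
move=> [_ /unif_continuousP fu] e e0.
have [|d d0 dP] := fu e%:C%C; first by rewrite ltcR.
have dE : d = (Re d)%:C%C by rewrite RRe_real// gtr0_real.
exists (Re d); first by rewrite -ltcR -dE.
move=> x y xB yB xy; have := dP (x, y).
rewrite ball_subspace_ball /subspace_ball/= mem_set// -!ball_normE/=.
rewrite /ball_/= !rnormE dE !ltcR; apply.
by split.
Qed.

(** Each point of the ball is joined to 0 by [N] steps of length less than [d], with [N] independent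
    of the point, and each step changes [f] by less than 1. *)
Lemma Au_bounded f : Au f ->
  exists M : R, forall x, ell2_ball x -> rnormC (f x) <= M.
Proof.
move=> /Au_uniform/(_ 1 ltr01)[d d0 dP].
pose N := (Num.trunc d^-1).+1.
have Nd : N%:R^-1 < d.
  by rewrite invf_plt ?posrE ?ltr0Sn// truncnS_gt.
exists (rnormC (f 0) + N%:R) => x; rewrite ell2_ballE => xB.
pose t k : R := k%:R / N%:R.
have tB k : (k <= N)%N -> ell2_ball ((t k)%:C%C *: x).
  move=> kN; rewrite ell2_ballE rnormZ -/(rnormC _) rnorm_real.
  have t0 : 0 <= t k by rewrite divr_ge0.
  rewrite ger0_norm//; apply: le_lt_trans xB.
  by rewrite ler_piMl ?rnorm_ge0// ler_pdivrMr ?ltr0Sn// mul1r ler_nat.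
have main k : (k <= N)%N -> rnormC (f ((t k)%:C%C *: x)) <= rnormC (f 0) + k%:R.
  elim: k => [_|k IH kN]; first by rewrite /t mul0r scale0r addr0.
  have := IH (ltnW kN).
  have := dP _ _ (tB _ kN) (tB _ (ltnW kN)).
  rewrite -scalerBl -rmorphB rnormZ -/(rnormC _) rnorm_real.
  have -> : t k.+1 - t k = N%:R^-1.
    by rewrite /t -mulrBl -natrB// subSnn mul1r.
  rewrite ger0_norm ?invr_ge0//.
  have xN : N%:R^-1 * rnorm x < d.
    by apply: le_lt_trans Nd; rewrite ler_piMr ?invr_ge0// ltW.
  move=> /(_ xN); set u := f _; set v := f _ => uv vk.
  have : rnormC u <= rnormC (u - v) + rnormC v.
    by have := ler_rnormCD (u - v) v; rewrite subrK.
  by rewrite -natr1; clear -uv vk; lra.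
have := main N (leqnn N); rewrite /t divff ?pnatr_eq0// scale1r.
by [].
Qed.

Lemma supnorm_lt1P (g : ell2 R -> ell2 R) : (supnorm g < 1)%E ->
  exists2 r : R, 0 <= r < 1 & forall x, ell2_ball x -> rnorm (g x) <= r.
Proof.
move=> g1.
have gs x : ell2_ball x -> ((rnorm (g x))%:E <= supnorm g)%E.
  by move=> xB; apply: ereal_sup_ubound; exists x.
have g0 : (0 <= supnorm g)%E.
  apply: le_trans (gs 0 _); first by rewrite lee_fin rnorm_ge0.
  by rewrite ell2_ballE rnorm0.
have gfin : supnorm g \is a fin_num by rewrite ge0_fin_numE// (lt_trans g1)// ltry.
exists (fine (supnorm g)).
  by rewrite fine_ge0//= -lte_fin fineK.
by move=> x xB; rewrite -lee_fin fineK// gs.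
Qed.

Lemma supnorm_le (W : normedModType R[i]) (f : ell2 R -> W) (M : R) :
  (forall x, ell2_ball x -> rnorm (f x) <= M) -> (supnorm f <= M%:E)%E.
Proof.
by move=> fM; apply: ge_ereal_sup => _ [x xB <-]; rewrite lee_fin; exact: fM.
Qed.

End uniform_continuity_on_the_ball.

(** * Nets generating a filter *)

Section nets_from_filters.
Context {T : Type} {U : set_system T} {UF : ProperFilter U}.

(* The net is indexed by the pointed members of the filter, ordered by reverse
   inclusion. *)
Lemma net_of_filter (D : set T) : U D ->
  exists (I : directed_set) (n : I -> T),
    (forall i, D (n i)) /\ n @ tails I --> U.
Proof.
move=> UD.
pose car := {s : set T * T | [/\ U s.1, s.1 s.2 & s.1 `<=` D]}.
pose le (s t : car) := (sval t).1 `<=` (sval s).1.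
have pt A : U A -> A `<=` D -> exists s : car, (sval s).1 = A.
  move=> UA AD; have [p Ap] := filter_ex UA.
  by exists (exist _ (A, p) (And3 UA Ap AD)).
have inh : inhabited car by have [s _] := pt D UD (@subset_refl _ D).
have dir s t : exists k, le s k /\ le t k.
  have [[Us _ sD] [Ut _ _]] := (svalP s, svalP t).
  have [k kE] := pt _ (filterI Us Ut) (subIset (or_introl sD)).
  by exists k; rewrite /le kE; split; [exact: subIsetl|exact: subIsetr].
pose I := @DirectedSet car le inh (fun _ _ => id)
  (fun s t k st tk p kp => st p (tk p kp)) dir.
exists I, (fun s : car => (sval s).2); split.
  by move=> s; have [_ sp sD] := svalP s; exact: sD.
move=> A UA; have [s sE] := pt _ (filterI UA UD) (@subIsetr _ _ _).
exists s => t st /=; have [_ tp _] := svalP t.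
by have := st _ tp; rewrite sE => -[].
Qed.

End nets_from_filters.

(** * The cluster set *)

Section perturbations.
Context {R : realType} {U : set_system (ell2 R)} {UU : UltraFilter U}.
Context (g : ell2 R -> ell2 R) (f : ell2 R -> R[i]^o) (a : ell2 R) (M : R)
  (UB : U (@ell2_ball R)) (fhol : holomorphic_on (@ell2_ball R) f)
  (fM : forall x, ell2_ball x -> rnormC (f x) <= M).

Definition perturbed (p : ell2 R) (t : R[i]) x : R[i]^o := f (g x + t *: (p - a)).

(** The operator [lim] is total; its value is meaningful for admissible [(t, x)], where boundedness
    of [f] makes the ultrafilter limit exist. *)
Definition limit_perturbed (t : R[i]) x : R[i]^o :=
  lim ((perturbed ^~ t ^~ x) @ U).

Definition admissible (t : R[i]) x :=
  forall p, ell2_ball p -> ell2_ball (g x + t *: (p - a)).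

Lemma admissible_bound t x : admissible t x ->
  \forall p \near U, rnormC (perturbed p t x) <= M.
Proof. by move=> tx; apply: filterS UB => p pB; apply: fM; exact: tx. Qed.

Lemma limit_perturbed_cvg t x : admissible t x ->
  (perturbed ^~ t ^~ x) @ U --> limit_perturbed t x.
Proof.
move=> tx; have [l lP] := ultralimit_exists (admissible_bound tx).
by apply/cvg_ex; exists l.
Qed.

Lemma limit_perturbed_bound t x : admissible t x ->
  rnormC (limit_perturbed t x) <= M.
Proof.
by move=> tx; exact: rnorm_limit_le (limit_perturbed_cvg tx) (admissible_bound tx).
Qed.

Lemma limit_perturbed_holomorphic_space t :
  holomorphic_on (@ell2_ball R) g ->
  (forall x, ell2_ball x -> admissible t x) ->
  holomorphic_on (@ell2_ball R) (limit_perturbed t).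
Proof.
move=> ghol tadm x; rewrite ell2_ballE => xB.
have rB y : rnorm (y - x) < 1 - rnorm x -> ell2_ball y.
  move=> yx; rewrite ell2_ballE; have := ler_rnorm_sub y x; lra.
apply: (@ultralimit_differentiable R _ _ U _ (fun p => perturbed p t) _ x
  (1 - rnorm x) M); first by rewrite subr_gt0.
  apply: filterS UB => p pB y /rB yB; split; last by apply: fM; exact: tadm.
  apply: (@differentiable_comp _ _ _ _ (fun y => g y + t *: (p - a)) f).
    by apply: differentiableD => //; exact: ghol.
  by apply: fhol; exact: tadm.
by move=> y /rB yB; apply: limit_perturbed_cvg; exact: tadm.
Qed.

(** The centre [c] is arbitrary because two kinds of discs occur: around 0 for every [x] of the
    ball, and around the points of the segment from 0 to 1 for [x0]. *)
Lemma limit_perturbed_holomorphic_parameter x (c : R[i]) (rho : R) :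
  (forall t, rnormC (t - c) < rho -> admissible t x) ->
  bounded_holomorphic (limit_perturbed ^~ x) c rho M.
Proof.
move=> cadm t tc; split; last by apply: limit_perturbed_bound; exact: cadm.
have tadm s : rnormC (s - t) < rho - rnormC (t - c) -> admissible s x.
  by move=> st; apply: cadm; have := ler_rnormC_dist s t c; lra.
apply: (@ultralimit_differentiable R R[i]^o _ U _
  (fun p => perturbed p ^~ x) _ t (rho - rnormC (t - c)) M).
- by rewrite subr_gt0.
- apply: filterS UB => p pB s /tadm sadm; split; last by apply: fM; exact: sadm.
  have /differentiable_epsP[L fL] := fhol (sadm _ pB).
  apply/differentiable_complexP; exists (L (p - a)).
  exact: is_differential_complex_derivative.
by move=> s /tadm; exact: limit_perturbed_cvg.
Qed.

End perturbations.

Section proposition.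
Context {R : realType}.

(** Pairing with a fixed [v] is a continuous functional, so the perturbation [t (p - a)] disappears
    in the limit although its norm need not tend to 0. *)
Lemma ell2_dot_wstar (U : set_system (ell2 R)) (UF : Filter U) (a : ell2 R) :
  (forall phi : {linear ell2 R -> R[i]^o}, continuous phi -> phi @ U --> phi a) ->
  forall (b : ell2 R) (t : R[i]) (v : ell2 R),
    (fun p => ell2_dot (b + t *: (p - a)) v) @ U --> ell2_dot b v.
Proof.
move=> Ua b t v; have [phi phic phiE] := ell2_dot_functional v.
have -> : (fun p => ell2_dot (b + t *: (p - a)) v) =
    (fun p => phi b + t *: (phi p - phi a)).
  by apply/funext => p; rewrite -phiE linearD linearZ/= linearB.
rewrite -phiE -[X in _ --> X]addr0 -(scaler0 _ t) -(subrr (phi a)).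
apply: cvgD; first exact: cvg_cst.
by apply: cvgZr; apply: cvgB; [exact: Ua|exact: cvg_cst].
Qed.

Lemma limit_perturbed_nonconstant (U : set_system (ell2 R)) (UU : UltraFilter U)
    (g : ell2 R -> ell2 R) (f : ell2 R -> R[i]^o) x (r e del : R) :
  Au f -> U (@ell2_ball R) -> rnorm (g x) <= r -> r < 1 -> 0 < e -> 0 < del ->
  U [set p | e <= rnormC (f p - f (g x))] ->
  exists2 z, rnormC z < del &
    limit_perturbed (U := U) g f (g x) z x != limit_perturbed (U := U) g f (g x) 0 x.
Proof.
move=> fA UB gr r1 e0 del0 Ue; apply: contrapT => nz.
have [M fM] := Au_bounded fA.
set a := g x in nz Ue gr *; pose psi t := limit_perturbed (U := U) g f a t x.
have psi_const z : rnormC z < del -> psi z - psi 0 = 0.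
  move=> zdel; apply/eqP; rewrite subr_eq0; apply/negPn/negP => zn.
  by apply: nz; exists z.
have g_ge0 := rnorm_ge0 a.
have pa p : ell2_ball p -> rnorm (p - a) < 2.
  by rewrite ell2_ballE => pB; have := ler_rnormB p a; lra.
(* The point is the convex combination [(1 - s) a + s p], of norm at most [(1 - s) r + s], plus
   [(t - s) (p - a)]. Since [|p - a| < 2], the second term has norm at most [(1 - r) (1 - s)],
   exactly the room left below 1. *)
have adm (s : R) t : 0 <= s < 1 -> rnormC (t - s%:C%C) < (1 - r) / 2 * (1 - s) ->
    admissible g a t x.
  move=> /andP[s0 s1] ts p pB; have := pa p pB; rewrite ell2_ballE in pB => p2.
  rewrite ell2_ballE -/a.
  have -> : a + t *: (p - a) = ((1 - s)%:C%C *: a + s%:C%C *: p)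
      + (t - s%:C%C) *: (p - a).
    have -> : (1 - s)%:C%C *: a + s%:C%C *: p = a + s%:C%C *: (p - a).
      by rewrite rmorphB/= scalerBl scale1r scalerBr addrAC addrA.
    by rewrite -addrA -scalerDl (addrCA s%:C%C) subrr addr0.
  have := ler_rnormD ((1 - s)%:C%C *: a + s%:C%C *: p) ((t - s%:C%C) *: (p - a)).
  have := ler_rnormD ((1 - s)%:C%C *: a) (s%:C%C *: p).
  rewrite !rnormZ -!/(rnormC _) !rnorm_real !ger0_norm//; last lra.
  have := rnorm_ge0 (p - a); have := rnorm_ge0 p.
  have := rnormC_ge0 (t - s%:C%C); nra.
have psi0 : psi 0 = f a.
  apply: (cvg_unique _ (limit_perturbed_cvg UB fM (adm 0 0 _ _))).
  - exact: norm_hausdorff.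
  - by rewrite lexx ltr01.
  - by rewrite subrr rnormC0 subr0 mulr1 divr_gt0// subr_gt0.
  have -> : (fun p => perturbed g f a p 0 x) = cst (f a).
    by apply/funext => p; rewrite /perturbed scale0r addr0.
  exact: cvg_cst.
have k0 : 0 < (1 - r) / 2 by rewrite divr_gt0// subr_gt0.
have hol s : 0 <= s < 1 ->
    bounded_holomorphic (fun t => psi t - psi 0) s%:C%C ((1 - r) / 2 * (1 - s)) (M + M).
  move=> s01 t ts.
  have [psid psiM] := limit_perturbed_holomorphic_parameter UB fA.1 fM
    (fun t => adm s t s01) ts.
  split; first by apply: differentiableB => //; exact: differentiable_cst.
  apply: le_trans (ler_rnormCB _ _) _; apply: lerD => //.
  rewrite psi0; apply: fM; rewrite ell2_ballE; lra.
have psis := identity_segment k0 del0 hol psi_const.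
have e2 : 0 < e / 2 by rewrite divr_gt0.
have [d d0 dP] := Au_uniform fA e2.
(* Now [p] and [a + s (p - a)] differ by [(1 - s) (p - a)], of norm below [d], so [f] changes by
   less than [e / 2]. If the limit at [s] were [f a], some [p] would satisfy [|f p - f a| < e]. The
   minimum with 1 keeps [s] nonnegative. *)
pose s : R := 1 - Num.min 1 (d / 2).
have m0 : 0 < Num.min 1 (d / 2) by rewrite lt_min ltr01 divr_gt0.
have m1 : Num.min 1 (d / 2) <= 1 by rewrite ge_min lexx.
have md : Num.min 1 (d / 2) <= d / 2 by rewrite ge_min lexx orbT.
have s01 : 0 <= s < 1 by rewrite /s; lra.
have sd : 1 - s <= d / 2 by rewrite /s; lra.
clearbody s.
have sadm : admissible g a s%:C%C x.
  apply: (adm s) => //; rewrite subrr rnormC0 mulr_gt0//; lra.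
have sc : (fun p => perturbed g f a p s%:C%C x) @ U -->
    limit_perturbed (U := U) g f a s%:C%C x by exact: limit_perturbed_cvg UB fM _ _ sadm.
have /cvg_rnormP/(_ _ e2) := sc.
have -> : limit_perturbed (U := U) g f a s%:C%C x = f a.
  by rewrite -psi0; apply: subr0_eq; exact: psis.
move=> near_fa; have [p [[pe pB] /= pfa]] := filter_ex (filterI (filterI Ue UB) near_fa).
have : rnormC (f p - perturbed g f a p s%:C%C x) < e / 2.
  apply: dP => //; first exact: sadm.
  have -> : p - (g x + s%:C%C *: (p - a)) = (1 - s)%:C%C *: (p - a).
    by rewrite rmorphB/= scalerBl scale1r opprD addrA.
  rewrite rnormZ -/(rnormC _) rnorm_real ger0_norm; last lra.
  by have := pa p pB; have := rnorm_ge0 (p - a); nra.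
have := ler_rnormC_dist (f p) (perturbed g f a p s%:C%C x) (f a).
rewrite /= in pe; clear -pe pfa; rewrite /rnormC in pe pfa *; lra.
Qed.

End proposition.

Theorem proposition3p2 (R : realType) (g : ell2 R -> ell2 R)
    (f0 : ell2 R -> R[i]^o) (x0 : ell2 R) :
  Hinfty (ell2 R) g -> (supnorm g < 1)%E ->
  Au f0 ->
  ell2_ball x0 -> ~ weakly_continuous_at f0 (g x0) ->
  contains_analytic_copy (cluster_set f0 g) (@unit_disk R).
Proof.
move=> [ghol _] /supnorm_lt1P[r /andP[r0 r1] gr] fA x0B nwc.
have [M fM] := Au_bounded fA.
set a := g x0 in nwc *.
have aB : ell2_ball a by rewrite ell2_ballE; apply: le_lt_trans (gr _ x0B) _.
have [U [e [UU e0 UB Ua Ue]]] := not_weakly_continuous_ultrafilter aB nwc.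
(* As [|p - a| < 2], a perturbation with [|t| < del] adds at most [(1 - r) / 2] to [r]. The bound
   [(1 + r) / 2] is uniform, so the sup norm itself is below 1. *)
pose del := (1 - r) / 4.
have del0 : 0 < del by rewrite divr_gt0// subr_gt0.
have bound t x p : rnormC t < del -> ell2_ball x -> ell2_ball p ->
    rnorm (g x + t *: (p - a)) <= (1 + r) / 2.
  move=> tdel xB; rewrite ell2_ballE => pB; rewrite ell2_ballE in aB.
  have := ler_rnormD (g x) (t *: (p - a)); rewrite rnormZ -/(rnormC t).
  have := ler_rnormB p a; have := gr x xB; have := rnormC_ge0 t.
  have := rnorm_ge0 (p - a); move: tdel; rewrite /del; nra.
have adm t x : rnormC t < del -> ell2_ball x -> admissible g a t x.
  move=> tdel xB p pB; rewrite ell2_ballE; apply: le_lt_trans (bound t x p tdel xB pB) _.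
  lra.
pose H t x := limit_perturbed (U := U) g f0 a t x.
have Hhol x : ell2_ball x -> bounded_holomorphic (H ^~ x) 0 del M.
  move=> xB; apply: limit_perturbed_holomorphic_parameter => //; first exact: fA.1.
  by move=> t; rewrite subr0 => tdel; exact: adm.
have [z zdel Hz] := limit_perturbed_nonconstant UU fA UB (gr _ x0B) r1 e0 del0 Ue.
rewrite -(subr0 z) in zdel.
have [c [rho [rho0 crho inj]]] := exists_injective_disc (Hhol _ x0B) zdel Hz.
rewrite subr0 in crho.
(* An affine map sends the unit disc onto the disc of injectivity, whose centre [c] need not be
   0. *)
pose tau (u : R[i]^o) : R[i]^o := c + u *: (rho%:C%C : R[i]^o).
have tauc u : unit_disk u -> rnormC (tau u - c) < rho.
  rewrite /unit_disk/= rnormE (ltcR _ 1) => u1.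
  rewrite /tau addrAC subrr add0r [_ *: _]/(_ * _) rnormM rnorm_real gtr0_norm//.
  by rewrite gtr_pMl.
have taudel u : unit_disk u -> rnormC (tau u) < del.
  by move=> /tauc uc; have := ler_rnormCD (tau u - c) c; rewrite subrK; lra.
exists (fun u => H (tau u)); split.
- move=> u v uD vD Huv.
  (* Equality at the single point [x0] already forces the parameters to agree. *)
  have := inj _ _ (tauc _ uD) (tauc _ vD) (Huv _ x0B).
  move=> /addrI; rewrite ![_ *: _]/(_ * _) => /mulIf; apply.
  by apply/eqP => /complexI rho_0; rewrite rho_0 ltxx in rho0.
- move=> u uD; have tdel := taudel u uD; split.
    split.
      by apply: (limit_perturbed_holomorphic_space UB fA.1 fM) => // x xB; exact: adm.
    apply: le_lt_trans (ltry M); apply: supnorm_le => x xB.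
    by apply: (limit_perturbed_bound UB fM); exact: adm.
  have [I [n [nB nU]]] := net_of_filter UB.
  exists I, (fun i x => g x + tau u *: (n i - a)); split.
  + move=> i; have Glt : (supnorm (fun x => (g x + tau u *: (n i - a))%R) < 1)%E.
      apply: (@le_lt_trans _ _ ((1 + r) / 2)%:E); last by rewrite lte_fin; lra.
      by apply: supnorm_le => x xB; exact: bound.
    split; last exact: Glt.
    split; last exact: lt_trans Glt (ltry _).
    move=> x xB; apply: (@differentiableD _ _ _ g (cst (tau u *: (n i - a)))).
      exact: ghol.
    exact: differentiable_cst.
  + move=> y v yB A vA.
    have UF : Filter U by exact: _.
    exact: (nU _ (@ell2_dot_wstar R U UF a Ua (g y) (tau u) v A vA)).
  move=> y yB A fA'; exact: (nU _ (limit_perturbed_cvg UB fM (adm _ _ tdel yB) fA')).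
move=> x xB u uD.
have [Hd _] := Hhol x xB (tau u) ltac:(by rewrite subr0; exact: taudel).
have taud : differentiable tau u.
  apply/differentiable_complexP; exists rho%:C%C => k k0; exists 1 => // h _.
  have -> : tau (u + h) - tau u - rho%:C%C * h = 0.
    by rewrite /tau -![_ *: _]/(_ * _); ring.
  by rewrite rnormC0 mulr_ge0 ?rnormC_ge0// ltW.
exact: (@differentiable_comp _ _ _ _ tau (H ^~ x) u taud Hd).
Qed.
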